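(* Let $\mathcal{H}$ and $\mathcal{K}$ be finite-dimensional complex Hilbert spaces, both of dimension greater than $1$. Let $\mathcal{HP}$ be the set of all Hermitian-preserving trace-preserving linear maps $B(\mathcal{H})\to B(\mathcal{K})$, equipped with the topology induced by any norm (on the real vector space of Hermitian-preserving maps). Then: (1) The set $\mathcal{SP}$ of SP maps in $\mathcal{HP}$ is open and unbounded in $\mathcal{HP}$ but not convex; it is star-shaped, and its star center equals $\mathcal{SP}\cap\mathcal{P}$. (2) The set $\mathcal{SN}$ of SN maps in $\mathcal{HP}$ is closed and unbounded in $\mathcal{HP}$ but not convex; it is star-shaped, and its star center equals $\mathcal{P}$. (3) The set $\mathcal{SPR}$ of SPR maps in $\mathcal{HP}$ is unbounded, neither open nor closed in $\mathcal{HP}$, and not convex; it is star-shaped, and its star center equals $\mathcal{P}$. (4) The set $\mathcal{P}$ of positive maps in $\mathcal{HP}$ is compact and convex. (5) The set $\mathcal{CP}$ of completely positive maps in $\mathcal{HP}$ is compact and convex.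
   Context: $B(\mathcal{H})$ denotes all linear operators on $\mathcal{H}$; a density matrix is a positive semidefinite operator of trace one. A map is Hermitian-preserving if $\Psi(X^\dagger)=\Psi(X)^\dagger$ and trace-preserving if $\operatorname{Tr}\Psi(X)=\operatorname{Tr}X$. An HP map $\Psi$ is SP (semi-positive) if there is an invertible density matrix $\rho\in B(\mathcal{H})$ with $\Psi(\rho)$ an invertible density matrix in $B(\mathcal{K})$. Let $\mathcal{K}_\Psi=\operatorname{Span}\big(\bigcup_{a\in B(\mathcal{H})}\operatorname{Range}(\Psi(a))\big)$; regarding $\Psi$ as a map into $B(\mathcal{K}_\Psi)$ (each $\Psi(a)$ maps into $\mathcal{K}_\Psi$ and vanishes on $\mathcal{K}_\Psi^\perp$), $\Psi$ is SPR (semi-positive after reduction) if this map into $B(\mathcal{K}_\Psi)$ is SP. An HPTP map is SN (semi-nonnegative) if there is a density matrix $\rho$ with $\Psi(\rho)$ a density matrix. A set $M$ is star-shaped if there is a point $c\in M$ such that the segment $\{\lambda x+(1-\lambda)c:\lambda\in[0,1]\}$ lies in $M$ for every $x\in M$; the star center of $M$ is the set of all such points $c$. *)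

(* Defs.v *)
From HB Require Import structures.
From mathcomp Require Import all_boot all_order all_algebra.
From mathcomp Require Import complex.
From mathcomp Require Import all_classical all_reals all_analysis.

Set Implicit Arguments.
Unset Strict Implicit.
Unset Printing Implicit Defensive.

Import Order.TTheory GRing.Theory Num.Theory.
Import numFieldNormedType.Exports.
Local Open Scope ring_scope.
Local Open Scope classical_set_scope.
Local Open Scope complex_scope.

Section QChannels.
Variable R : realType.
Local Notation C := (R[i]).

Definition adjmx p q (A : 'M[C]_(p, q)) : 'M[C]_(q, p) := (map_mx conjc A)^T.

Definition psdmx p (A : 'M[C]_p) : Prop :=
  adjmx A = A /\ forall v : 'cV[C]_p, 0 <= (adjmx v *m A *m v) 0 0.

Definition density p (A : 'M[C]_p) : Prop := psdmx A /\ \tr A = 1.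

(* A linear map B(C^n) -> B(C^m) is represented by its matrix
   T : 'M_(n*n, m*m) acting on vectorized matrices. *)
Definition app n m (T : 'M[C]_(n * n, m * m)) (X : 'M[C]_n) : 'M[C]_m :=
  vec_mx (mxvec X *m T).

Definition HermPres n m (T : 'M[C]_(n * n, m * m)) : Prop :=
  forall X : 'M[C]_n, app T (adjmx X) = adjmx (app T X).

Definition TracePres n m (T : 'M[C]_(n * n, m * m)) : Prop :=
  forall X : 'M[C]_n, \tr (app T X) = \tr X.

Definition SP_fun n d (f : 'M[C]_n -> 'M[C]_d) : Prop :=
  exists rho : 'M[C]_n, [/\ density rho, rho \in unitmx,
                           density (f rho) & f rho \in unitmx].

Definition SP_map n m (T : 'M[C]_(n * n, m * m)) : Prop := SP_fun (app T).

Definition SN_map n m (T : 'M[C]_(n * n, m * m)) : Prop :=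
  exists rho : 'M[C]_n, density rho /\ density (app T rho).

(* SPR: V : 'M_(m, d) is an isometry (orthonormal columns) whose range is
   K_Psi = span of the union of the ranges of Psi(a) (the smallest subspace
   containing all of them); Psi regarded as a map into B(K_Psi) is
   a |-> V^* Psi(a) V.  Range(A) is encoded as the row space of A^T. *)
Definition SPR_map n m (T : 'M[C]_(n * n, m * m)) : Prop :=
  exists d (V : 'M[C]_(m, d)),
    [/\ adjmx V *m V = 1%:M,
        forall a : 'M[C]_n, ((app T a)^T <= V^T)%MS,
        forall p (W : 'M[C]_(p, m)),
          (forall a : 'M[C]_n, ((app T a)^T <= W)%MS) -> (V^T <= W)%MS
      & SP_fun (fun a => adjmx V *m app T a *m V)].

Definition positive_map n m (T : 'M[C]_(n * n, m * m)) : Prop :=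
  forall X : 'M[C]_n, psdmx X -> psdmx (app T X).

(* (a,b) block of a matrix on C^k (x) C^n *)
Definition blk k n (a b : 'I_k) (X : 'M[C]_(k * n)) : 'M[C]_n :=
  \matrix_(i, j) X (mxvec_index a i) (mxvec_index b j).

Definition ampl k n m (T : 'M[C]_(n * n, m * m)) (X : 'M[C]_(k * n))
  : 'M[C]_(k * m) :=
  \matrix_(r, s) \sum_(a < k) \sum_(b < k) \sum_(i < m) \sum_(j < m)
     (((r == mxvec_index a i) && (s == mxvec_index b j))%:R
        * app T (blk a b X) i j).

Definition cp_map n m (T : 'M[C]_(n * n, m * m)) : Prop :=
  forall k (X : 'M[C]_(k * n)), psdmx X -> psdmx (ampl T X).

Definition HPset n m : set 'M[C]_(n * n, m * m) :=
  [set T | HermPres T /\ TracePres T].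
Definition SPset n m : set 'M[C]_(n * n, m * m) :=
  [set T | @HPset n m T /\ SP_map T].
Definition SNset n m : set 'M[C]_(n * n, m * m) :=
  [set T | @HPset n m T /\ SN_map T].
Definition SPRset n m : set 'M[C]_(n * n, m * m) :=
  [set T | @HPset n m T /\ SPR_map T].
Definition Pset n m : set 'M[C]_(n * n, m * m) :=
  [set T | @HPset n m T /\ positive_map T].
Definition CPset n m : set 'M[C]_(n * n, m * m) :=
  [set T | @HPset n m T /\ cp_map T].

(* Topology: HP is a real vector space; we transport along the injective
   R-linear map realify into the real normed space 'M[R]_(p, q + q)
   (real and imaginary parts).  Its max-norm restricts to a norm on HP. *)
Definition realify p q (A : 'M[C]_(p, q)) : 'M[R]_(p, q + q) :=
  row_mx (map_mx (fun z : C => complex.Re z) A) (map_mx (fun z : C => complex.Im z) A).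

Definition open_in p q (H S : set 'M[C]_(p, q)) : Prop :=
  S `<=` H /\ exists U : set 'M[R]_(p, q + q),
      open U /\ S = H `&` ((@realify p q) @^-1` U).
Definition closed_in p q (H S : set 'M[C]_(p, q)) : Prop :=
  S `<=` H /\ exists U : set 'M[R]_(p, q + q),
      closed U /\ S = H `&` ((@realify p q) @^-1` U).
Definition cbounded p q (S : set 'M[C]_(p, q)) : Prop :=
  bounded_set ((@realify p q) @` S).
Definition ccompact p q (S : set 'M[C]_(p, q)) : Prop :=
  compact ((@realify p q) @` S).

Definition segment_in p q (S : set 'M[C]_(p, q)) (c x : 'M[C]_(p, q)) :=
  forall l : R, 0 <= l <= 1 -> S ((l%:C) *: x + ((1 - l)%:C) *: c).
Definition cconvex p q (S : set 'M[C]_(p, q)) : Prop :=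
  forall x y, S x -> S y -> segment_in S y x.
Definition star_center p q (S : set 'M[C]_(p, q)) : set 'M[C]_(p, q) :=
  [set c | S c /\ forall x, S x -> segment_in S c x].
Definition star_shaped p q (S : set 'M[C]_(p, q)) : Prop :=
  exists c, star_center S c.

End QChannels.

Arguments HPset R n m : clear implicits.
Arguments SPset R n m : clear implicits.
Arguments SNset R n m : clear implicits.
Arguments SPRset R n m : clear implicits.
Arguments Pset R n m : clear implicits.
Arguments CPset R n m : clear implicits.

(* Main.v *)
Require Import Defs.
From HB Require Import structures.
From mathcomp Require Import all_boot all_order all_algebra.
From mathcomp Require Import complex.
From mathcomp Require Import all_classical all_reals all_analysis.
From mathcomp Require Import ring lra.

Set Implicit Arguments.
Unset Strict Implicit.
Unset Printing Implicit Defensive.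

Import Order.TTheory GRing.Theory Num.Theory.
Import numFieldNormedType.Exports.
Local Open Scope ring_scope.
Local Open Scope classical_set_scope.
Local Open Scope complex_scope.

(** Write [q(A, v) = Re (v^* A v)].  Three facts carry the theorem.

    - An HPTP map [T] is SPR iff some invertible density [rho] has [T rho] psd
      and every [v] with [q(T rho, v) = 0] is killed by all [T a]; hence
      SP is contained in SPR, SPR in SN, and positive maps are SPR.  Mixing
      with a positive map preserves each of the conditions.
    - If [c] is not positive, there are an invertible density [rho] and [v]
      with [q(c rho, v) < 0]; the segment from [c] to a suitable SP map that
      returns the maximally mixed state on [rho] leaves SN.  So the star
      centers of SP, SPR and SN lie in P.
    - P is compact.  Since a convex set is its own star center and SP contains
      a line, none of the three sets is convex.

    Openness of SP and closedness of SN are the tube lemma over the compact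
    unit sphere and the compact set of densities.  For [E_j] the diagonal
    matrix units, SPR is not open at [tr(Y) E_0], and [e -> 0] in
    [tr(Y) E_0 + (e tr(Y) - Y_00) (E_1 - E_0)] shows that it is not closed. *)

(** * Real and imaginary parts of complex numbers *)

Section ComplexParts.
Variable R : realType.
Local Notation C := (R[i]).
Implicit Types x y : C.

Lemma RecD x y : complex.Re (x + y) = complex.Re x + complex.Re y.
Proof. by case: x; case: y. Qed.

Lemma ImcD x y : complex.Im (x + y) = complex.Im x + complex.Im y.
Proof. by case: x; case: y. Qed.

Lemma RecM x y : complex.Re (x * y) =
  complex.Re x * complex.Re y - complex.Im x * complex.Im y.
Proof. by case: x; case: y. Qed.

Lemma ImcM x y : complex.Im (x * y) =
  complex.Re x * complex.Im y + complex.Im x * complex.Re y.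
Proof. by case: x; case: y. Qed.

Lemma RecZ (r : R) y : complex.Re (r%:C * y) = r * complex.Re y.
Proof. by rewrite RecM /= mul0r subr0. Qed.

Lemma Rec_sum I (r : seq I) (P : pred I) (F : I -> C) :
  complex.Re (\sum_(i <- r | P i) F i) = \sum_(i <- r | P i) complex.Re (F i).
Proof. exact: (big_morph _ RecD). Qed.

Lemma Rec_conj x : complex.Re (conjc x) = complex.Re x.
Proof. by case: x. Qed.

Lemma Imc_conj x : complex.Im (conjc x) = - complex.Im x.
Proof. by case: x. Qed.

Lemma ge0_complex x : (0 <= x) = (complex.Im x == 0) && (0 <= complex.Re x).
Proof. by rewrite lecE. Qed.

Lemma complex_eqP x y :
  complex.Re x = complex.Re y -> complex.Im x = complex.Im y -> x = y.
Proof. by case: x; case: y => /= ? ? ? ? -> ->. Qed.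

End ComplexParts.

(** * Hermitian, positive semidefinite and positive definite matrices *)

Section HermitianMatrices.
Variable R : realType.
Local Notation C := (R[i]).

Lemma adjmxK p q (A : 'M[C]_(p, q)) : adjmx (adjmx A) = A.
Proof. by apply/matrixP => i j; rewrite !mxE conjcK. Qed.

Lemma adjmxD p q (A B : 'M[C]_(p, q)) : adjmx (A + B) = adjmx A + adjmx B.
Proof. by apply/matrixP => i j; rewrite !mxE rmorphD. Qed.

Lemma adjmxZ p q a (A : 'M[C]_(p, q)) : adjmx (a *: A) = conjc a *: adjmx A.
Proof. by apply/matrixP => i j; rewrite !mxE rmorphM. Qed.

Lemma adjmxZr p q (r : R) (A : 'M[C]_(p, q)) :
  adjmx (r%:C *: A) = r%:C *: adjmx A.
Proof. by rewrite adjmxZ conjc_real. Qed.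

Lemma adjmxN p q (A : 'M[C]_(p, q)) : adjmx (- A) = - adjmx A.
Proof. by apply/matrixP => i j; rewrite !mxE rmorphN. Qed.

Lemma adjmxM p q r (A : 'M[C]_(p, q)) (B : 'M[C]_(q, r)) :
  adjmx (A *m B) = adjmx B *m adjmx A.
Proof. by rewrite /adjmx map_mxM trmx_mul. Qed.

Lemma adjmx_scalar p (a : C) : adjmx (a%:M : 'M[C]_p) = (conjc a)%:M.
Proof. by apply/matrixP => i j; rewrite !mxE rmorphMn eq_sym. Qed.

Lemma adjmx1 p : adjmx (1%:M : 'M[C]_p) = 1%:M.
Proof. by rewrite adjmx_scalar conjc1. Qed.

Lemma mxtrace_adj p (A : 'M[C]_p) : \tr (adjmx A) = conjc (\tr A).
Proof. by rewrite rmorph_sum; apply: eq_bigr => i _; rewrite !mxE. Qed.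

(** Cartesian decomposition, which reduces statements about all arguments of a map to Hermitian
    arguments. *)
Lemma hermitian_decomp p (A : 'M[C]_p) : exists H K : 'M[C]_p,
  [/\ adjmx H = H, adjmx K = K & A = H + 'i *: K].
Proof.
exists ((2^-1 : R)%:C *: (A + adjmx A)).
exists ((2^-1 : R)%:C *: ('i *: (adjmx A - A))).
split.
- by rewrite adjmxZr adjmxD adjmxK addrC.
- rewrite adjmxZr adjmxZ adjmxD adjmxN adjmxK; congr (_ *: _).
  apply/matrixP => i j; rewrite !mxE; simpc.
  by case: (A i j) (A j i) => ? ? [? ?]; simpc.
- apply/matrixP => i j; rewrite !mxE; case: (A i j) (A j i) => a b [c d].
  by apply: complex_eqP => /=; field.
Qed.

(** The form of a Hermitian matrix is real; keeping its real part moves order arguments from the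
    partial order of the complex numbers to [R]. *)
Definition qform p (A : 'M[C]_p) (v : 'cV[C]_p) : R :=
  complex.Re ((adjmx v *m A *m v) 0 0).

Lemma qformD p (A B : 'M[C]_p) v : qform (A + B) v = qform A v + qform B v.
Proof. by rewrite /qform mulmxDr mulmxDl mxE RecD. Qed.

Lemma qformZ p (r : R) (A : 'M[C]_p) v : qform (r%:C *: A) v = r * qform A v.
Proof. by rewrite /qform -scalemxAr -scalemxAl mxE RecZ. Qed.

Lemma qformN p (A : 'M[C]_p) v : qform (- A) v = - qform A v.
Proof. by rewrite -[- A]scaleN1r -[-1](rmorphN1 (real_complex R)) qformZ mulN1r. Qed.

Lemma qformZv p (a : C) (A : 'M[C]_p) v :
  qform A (a *: v) = (complex.Re a ^+ 2 + complex.Im a ^+ 2) * qform A v.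
Proof.
rewrite /qform adjmxZ -!scalemxAl -scalemxAr !mxE mulrA.
have -> : conjc a * a = (complex.Re a ^+ 2 + complex.Im a ^+ 2)%:C.
  by case: a => x y; apply: complex_eqP => /=; ring.
by rewrite RecZ.
Qed.

Lemma qform0 p (A : 'M[C]_p) : qform A 0 = 0.
Proof. by rewrite /qform mulmx0 mxE. Qed.

Lemma qform_conj p q (W : 'M[C]_(p, q)) (A : 'M[C]_p) v :
  qform (adjmx W *m A *m W) v = qform A (W *m v).
Proof. by rewrite /qform adjmxM !mulmxA. Qed.

Lemma qform_ker p (A : 'M[C]_p) v : A *m v = 0 -> qform A v = 0.
Proof. by move=> Av; rewrite /qform -mulmxA Av mulmx0 mxE. Qed.

Lemma hermitian_form_real p (A : 'M[C]_p) (v : 'cV[C]_p) : adjmx A = A ->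
  complex.Im ((adjmx v *m A *m v) 0 0) = 0.
Proof.
move=> hA; set M := _ *m _.
have : adjmx M = M by rewrite /M !adjmxM adjmxK hA mulmxA.
move=> /matrixP/(_ 0 0); rewrite mxE mxE; case: (M 0 0) => a b [] /= ?.
lra.
Qed.

Lemma psdmxE p (A : 'M[C]_p) :
  psdmx A <-> adjmx A = A /\ forall v, 0 <= qform A v.
Proof.
split=> -[hA pA]; split=> // v; have := pA v; rewrite ge0_complex.
  by case/andP.
by rewrite (hermitian_form_real v hA) eqxx.
Qed.

Lemma psd_herm p (A : 'M[C]_p) : psdmx A -> adjmx A = A.
Proof. by case. Qed.

Lemma psd_qform p (A : 'M[C]_p) v : psdmx A -> 0 <= qform A v.
Proof. by move/psdmxE => [_]. Qed.

Lemma psdD p (A B : 'M[C]_p) : psdmx A -> psdmx B -> psdmx (A + B).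
Proof.
move=> /psdmxE[hA pA] /psdmxE[hB pB]; apply/psdmxE; split.
  by rewrite adjmxD hA hB.
by move=> v; rewrite qformD addr_ge0.
Qed.

Lemma psdZ p (r : R) (A : 'M[C]_p) : 0 <= r -> psdmx A -> psdmx (r%:C *: A).
Proof.
move=> r0 /psdmxE[hA pA]; apply/psdmxE; split; first by rewrite adjmxZr hA.
by move=> v; rewrite qformZ mulr_ge0.
Qed.

Lemma psd_conj p q (W : 'M[C]_(p, q)) (A : 'M[C]_p) :
  psdmx A -> psdmx (adjmx W *m A *m W).
Proof.
move=> /psdmxE[hA pA]; apply/psdmxE; split.
  by rewrite !adjmxM adjmxK hA mulmxA.
by move=> v; rewrite qform_conj.
Qed.

Lemma qform1E p (v : 'cV[C]_p) :
  qform 1%:M v = \sum_i (complex.Re (v i 0) ^+ 2 + complex.Im (v i 0) ^+ 2).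
Proof.
rewrite /qform mulmx1 mxE Rec_sum; apply: eq_bigr => i _.
by rewrite !mxE RecM Rec_conj Imc_conj; ring.
Qed.

Lemma qform1_gt0 p (v : 'cV[C]_p) : v != 0 -> 0 < qform 1%:M v.
Proof.
have t i : 0 <= complex.Re (v i 0) ^+ 2 + complex.Im (v i 0) ^+ 2.
  by rewrite addr_ge0 ?sqr_ge0.
move=> v0; rewrite lt_def qform1E sumr_ge0 // andbT.
apply: contra v0; rewrite psumr_eq0 // => /allP v0.
apply/eqP/matrixP => i j; rewrite ord1 mxE.
have := v0 i (mem_index_enum i); rewrite paddr_eq0 ?sqr_ge0 // !sqrf_eq0.
by move=> /andP[/eqP a /eqP b]; apply: complex_eqP.
Qed.

(* The discriminant argument of Cauchy-Schwarz, along the line v + t (A v). *)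
Lemma psd_qform_eq0 p (A : 'M[C]_p) v : psdmx A -> qform A v = 0 -> A *m v = 0.
Proof.
move=> psA Av0; apply/eqP; apply: contraT => w0.
set w := A *m v in w0 *; have hA := psd_herm psA.
have N0 := qform1_gt0 w0; set N := qform _ _ in N0.
have q0 := psd_qform w psA; set q := qform A w in q0.
have E (t : R) : qform A (v + t%:C *: w) = 2 * t * N + t ^+ 2 * q.
  rewrite /qform adjmxD adjmxZr !mulmxDl !mulmxDr -?scalemxAl -?scalemxAr.
  rewrite -!mulmxA -/w.
  have -> : adjmx v *m (A *m w) = adjmx w *m w.
    by rewrite mulmxA -{1}hA -adjmxM.
  have DE (X Y : 'M[C]_1) : complex.Re ((X + Y) 0 0)
      = complex.Re (X 0 0) + complex.Re (Y 0 0) by rewrite mxE RecD.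
  have ZE (X : 'M[C]_1) : complex.Re ((t%:C *: X) 0 0)
      = t * complex.Re (X 0 0) by rewrite mxE RecZ.
  rewrite -?scalemxAl !(DE, ZE).
  have -> : complex.Re ((adjmx v *m w) 0 0) = 0 by rewrite /w mulmxA.
  have -> : complex.Re ((adjmx w *m w) 0 0) = N by rewrite /N /qform mulmx1.
  have -> : complex.Re ((adjmx w *m (A *m w)) 0 0) = q by rewrite mulmxA.
  ring.
have q1 : 0 < q + 1 by rewrite ltr_wpDl.
(* The summand 1 keeps the denominator positive when q = 0; at this t the form is negative as soon
   as w is nonzero. *)
have := psd_qform (v + (- (N / (q + 1)))%:C *: w) psA; rewrite E.
have -> : 2 * (- (N / (q + 1))) * N + (- (N / (q + 1))) ^+ 2 * q
    = - (N ^+ 2 * (q + 2) / (q + 1) ^+ 2).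
  by field; rewrite gt_eqF.
rewrite oppr_ge0 leNgt => /negP; case.
by rewrite divr_gt0 ?exprn_gt0 // mulr_gt0 ?exprn_gt0 // ltr_wpDl.
Qed.

(** By [pdmxE] this is psd together with invertible, in the shape from which openness can be read
    off. *)
Definition pdmx p (A : 'M[C]_p) : Prop :=
  adjmx A = A /\ forall v, v != 0 -> 0 < qform A v.

Lemma unitmx_injP p (A : 'M[C]_p) :
  (forall v : 'cV[C]_p, A *m v = 0 -> v = 0) -> A \in unitmx.
Proof.
move=> inj; rewrite -unitmx_tr -row_free_unit -kermx_eq0; apply/eqP.
apply/row_matrixP => i; rewrite row0; apply: trmx_inj; rewrite trmx0.
apply: inj; apply: trmx_inj; rewrite trmx_mul trmxK trmx0.
by apply/sub_kermxP; rewrite row_sub.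
Qed.

Lemma pdmx_psd p (A : 'M[C]_p) : pdmx A -> psdmx A.
Proof.
move=> [hA pA]; apply/psdmxE; split=> // v.
by have [->|/pA/ltW//] := eqVneq v 0; rewrite qform0.
Qed.

(** A psd matrix kills every vector on which its form vanishes, so invertibility leaves only v =
    0. *)
Lemma pdmxE p (A : 'M[C]_p) : pdmx A <-> psdmx A /\ A \in unitmx.
Proof.
split=> [pdA|[psA uA]].
  split; first exact: pdmx_psd.
  apply: unitmx_injP => v /qform_ker Av; apply/eqP/contraT => /pdA.2.
  by rewrite Av ltxx.
split; first exact: psd_herm.
move=> v v0; rewrite lt_def psd_qform // andbT; apply: contra v0.
move=> /eqP/(psd_qform_eq0 psA) Av.
by rewrite -[v](mulKmx uA) Av mulmx0.
Qed.

Lemma pdmx1 p : pdmx (1%:M : 'M[C]_p).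
Proof. by split; [exact: adjmx1 | exact: qform1_gt0]. Qed.

Lemma pdmxD p (A B : 'M[C]_p) : psdmx A -> pdmx B -> pdmx (A + B).
Proof.
move=> psA [hB pB]; split; first by rewrite adjmxD hB psd_herm.
by move=> v v0; rewrite qformD ltr_wpDl ?pB ?psd_qform.
Qed.

Lemma pdmxZ p (r : R) (A : 'M[C]_p) : 0 < r -> pdmx A -> pdmx (r%:C *: A).
Proof.
move=> r0 [hA pA]; split; first by rewrite adjmxZr hA.
by move=> v v0; rewrite qformZ mulr_gt0 ?pA.
Qed.

Lemma psd_diag_ge0 p (A : 'M[C]_p) i : psdmx A -> 0 <= complex.Re (A i i).
Proof.
move=> /(psd_qform (delta_mx i 0)); congr (_ <= _); rewrite /qform.
have -> : adjmx (delta_mx i 0 : 'cV[C]_p) = delta_mx 0 i.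
  by apply/matrixP => a b; rewrite !mxE andbC conjc_nat.
by rewrite -rowE -colE !mxE.
Qed.

Lemma psd_diag_le_trace p (A : 'M[C]_p) i : psdmx A ->
  complex.Re (A i i) <= complex.Re (\tr A).
Proof.
move=> psA; rewrite /mxtrace Rec_sum (bigD1 i) //= lerDl.
by apply: sumr_ge0 => j _; apply: psd_diag_ge0.
Qed.

Lemma qform_delta2 p (A : 'M[C]_p) i j (a : C) : adjmx A = A ->
  qform A (delta_mx i 0 + a *: delta_mx j 0) = complex.Re (A i i) +
    (complex.Re a ^+ 2 + complex.Im a ^+ 2) * complex.Re (A j j)
    + 2 * complex.Re (a * A i j).
Proof.
move=> hA; rewrite /qform.
have ad k : adjmx (delta_mx k 0 : 'cV[C]_p) = delta_mx 0 k.
  by apply/matrixP => x y; rewrite !mxE andbC conjc_nat.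
rewrite adjmxD adjmxZ !ad !mulmxDl !mulmxDr -!scalemxAl -!scalemxAr.
rewrite -!rowE -!colE !mxE !RecD.
have -> : A j i = conjc (A i j) by rewrite -{1}hA !mxE.
case: (A i j) (A j j) a => x y [z t] [u v] /=; ring.
Qed.

(** The test vectors e_i + a e_j with a = 1, -1, i, -i bound both parts of A_ij by (A_ii + A_jj)/2,
    and each diagonal entry is at most the trace. *)
Lemma psd_entry_bound p (A : 'M[C]_p) i j : psdmx A ->
  `|complex.Re (A i j)| <= complex.Re (\tr A) /\
  `|complex.Im (A i j)| <= complex.Re (\tr A).
Proof.
move=> psA; have hA := psd_herm psA.
have Q a := psd_qform (delta_mx i 0 + a *: delta_mx j 0) psA.
have di := psd_diag_le_trace i psA; have dj := psd_diag_le_trace j psA.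
have := Q 1; have := Q (-1); have := Q 'i; have := Q (- 'i).
rewrite !qform_delta2 //; case: (A i j) => x y /= q1 q2 q3 q4.
by split; rewrite ler_norml; apply/andP; split; lra.
Qed.

End HermitianMatrices.

(** * Tube lemma and compact sets of real matrices *)

Section Topology.

(** The tube lemma, read off from the near-covering form of compactness. *)
Lemma open_forall_compact (X Y : topologicalType) (K : set X)
    (G : set (X * Y)) : compact K -> open G ->
  open [set y | forall x, K x -> G (x, y)].
Proof.
move=> /compact_near_coveringP cK oG; rewrite openE => y Gy.
apply: (cK Y (nbhs y) (fun y x => G (x, y))) => x Kx.
have : nbhs (x, y) G by exact: (open_nbhs_nbhs (conj oG (Gy _ Kx))).
by apply: filterS => -[].
Qed.

(** The tube lemma applied to the complement: projection along a compact factor is a closed map. *)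
Lemma closed_exists_compact (X Y : topologicalType) (K : set X)
    (G : set (X * Y)) : compact K -> closed G ->
  closed [set y | exists x, K x /\ G (x, y)].
Proof.
move=> cK cG; rewrite -openC.
have := open_forall_compact cK (closed_openC cG); congr open.
apply/seteqP; split=> y /= Gy; first by move=> [x [Kx Gxy]]; exact: Gy Gxy.
by move=> x Kx Gxy; apply: Gy; exists x.
Qed.

Lemma continuous_mx (R : realType) (X : topologicalType) p q
    (f : X -> 'M[R]_(p, q)) :
  (forall i j, continuous (fun x => f x i j)) -> continuous f.
Proof.
move=> cf x A [P fP sPA]; apply: filterS sPA _ => /=.
by apply: filter_forall => i; apply: filter_forall => j; exact/cf/fP.
Qed.

(** The set lies in the image under [vec_mx] of a cube, which is compact as a product of
    segments. *)
Lemma closed_bounded_mx_compact (R : realType) p q (A : set 'M[R]_(p, q))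
    (B : R) : (forall t, A t -> forall i j, `|t i j| <= B) -> closed A ->
  compact A.
Proof.
move=> AB cA.
have cbox : compact [set v : 'rV[R]_(p * q) |
    forall i, v ord0 i \in `[- B, B]%R].
  apply: (@rV_compact _ _ (fun=> `[- B, B]%classic)) => i.
  exact: segment_compact.
have cvec : continuous (@vec_mx R p q).
  apply: continuous_mx => i j.
  rewrite (_ : (fun v => _) = fun v : 'rV[R]_(p * q) => v 0 (mxvec_index i j)).
    exact: coord_continuous.
  by apply/funext => v; rewrite mxE.
apply: (subclosed_compact cA (continuous_compact _ cbox)).
  exact/continuous_subspaceT/cvec.
move=> t At; exists (mxvec t); last exact: mxvecK.
case/mxvec_indexP => i j /=; rewrite mxvecE in_itv /=.
by rewrite -ler_norml AB.
Qed.

Lemma closed_forall (X : topologicalType) J (P : J -> X -> Prop) :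
  (forall i, closed [set x | P i x]) -> closed [set x | forall i, P i x].
Proof.
move=> cP; have := @closed_bigI X J setT (fun i => [set x | P i x]).
have -> : \bigcap_(i in setT) [set x | P i x] = [set x | forall i, P i x].
  by apply/seteqP; split=> x /= Px i; [exact: Px i I|move=> _; exact: Px].
by apply=> i _; exact: cP.
Qed.

Lemma closed_preimage (X Y : topologicalType) (f : X -> Y) (D : set Y) :
  continuous f -> closed D -> closed [set x | D (f x)].
Proof. by move=> cf cD; apply: closed_comp => // x _; exact: cf. Qed.

Lemma open_preimage (X Y : topologicalType) (f : X -> Y) (D : set Y) :
  continuous f -> open D -> open [set x | D (f x)].
Proof. by move=> cf cD; apply: open_comp => // x _; exact: cf. Qed.

End Topology.

(** * Continuity of complex matrix-valued functions *)

Section ComplexContinuity.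
Variable R : realType.
Local Notation C := (R[i]).
Variable X : topologicalType.

(** Splitting into real and imaginary parts matches the topology that [realify] puts on the maps. *)
Definition ccont (f : X -> C) : Prop :=
  continuous (fun x => complex.Re (f x)) /\ continuous (fun x => complex.Im (f x)).

Lemma ccont_cst c : ccont (fun=> c).
Proof. by split=> x; exact: cvg_cst. Qed.

Lemma ccontD f g : ccont f -> ccont g -> ccont (fun x => f x + g x).
Proof.
move=> [fr fi] [gr gi]; split.
- under eq_fun do rewrite RecD.
  by move=> x; apply: cvgD; [exact: fr|exact: gr].
- under eq_fun do rewrite ImcD.
  by move=> x; apply: cvgD; [exact: fi|exact: gi].
Qed.

Lemma ccontM f g : ccont f -> ccont g -> ccont (fun x => f x * g x).
Proof.
move=> [fr fi] [gr gi]; split.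
- under eq_fun do rewrite RecM.
  move=> x; apply: cvgB; apply: cvgM; [exact: fr|exact: gr|exact: fi|exact: gi].
- under eq_fun do rewrite ImcM.
  move=> x; apply: cvgD; apply: cvgM; [exact: fr|exact: gi|exact: fi|exact: gr].
Qed.

Lemma ccont_conj f : ccont f -> ccont (fun x => conjc (f x)).
Proof.
move=> [fr fi]; split.
- by under eq_fun do rewrite Rec_conj.
- by under eq_fun do rewrite Imc_conj; move=> x; apply: cvgN; exact: fi.
Qed.

Lemma ccont_sum I (r : seq I) (P : pred I) (F : I -> X -> C) :
  (forall i, ccont (F i)) -> ccont (fun x => \sum_(i <- r | P i) F i x).
Proof.
move=> cF; elim: r => [|i r IH].
  by under eq_fun do rewrite big_nil; exact: ccont_cst.
under eq_fun do rewrite big_cons; case: (P i) => //.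
by apply: ccontD.
Qed.

Definition mcont p q (f : X -> 'M[C]_(p, q)) : Prop :=
  forall i j, ccont (fun x => f x i j).

Lemma mcont_cst p q (A : 'M[C]_(p, q)) : mcont (fun=> A).
Proof. by move=> i j; exact: ccont_cst. Qed.

Lemma mcontD p q (f g : X -> 'M[C]_(p, q)) :
  mcont f -> mcont g -> mcont (fun x => f x + g x).
Proof.
by move=> cf cg i j; under eq_fun do rewrite mxE; exact: ccontD.
Qed.

Lemma mcontZ p q (a : X -> C) (f : X -> 'M[C]_(p, q)) :
  ccont a -> mcont f -> mcont (fun x => a x *: f x).
Proof.
by move=> ca cf i j; under eq_fun do rewrite mxE; exact: ccontM.
Qed.

Lemma mcontM p q r (f : X -> 'M[C]_(p, q)) (g : X -> 'M[C]_(q, r)) :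
  mcont f -> mcont g -> mcont (fun x => f x *m g x).
Proof.
move=> cf cg i j; under eq_fun do rewrite mxE.
by apply: ccont_sum => k; exact: ccontM.
Qed.

Lemma mcont_adj p q (f : X -> 'M[C]_(p, q)) :
  mcont f -> mcont (fun x => adjmx (f x)).
Proof.
by move=> cf i j; under eq_fun do rewrite !mxE; exact: ccont_conj.
Qed.

Lemma mcont_mxvec p q (f : X -> 'M[C]_(p, q)) :
  mcont f -> mcont (fun x => mxvec (f x)).
Proof.
move=> cf i; case/mxvec_indexP=> j k; rewrite ord1.
by under eq_fun do rewrite mxvecE; exact: cf.
Qed.

Lemma mcont_app n m (T : X -> 'M[C]_(n * n, m * m)) (A : X -> 'M[C]_n) :
  mcont T -> mcont A -> mcont (fun x => app (T x) (A x)).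
Proof.
move=> cT cA i j; rewrite /app; under eq_fun do rewrite mxE.
exact: (mcontM (mcont_mxvec cA) cT).
Qed.

Lemma qform_continuous p (A : X -> 'M[C]_p) (v : X -> 'cV[C]_p) :
  mcont A -> mcont v -> continuous (fun x => qform (A x) (v x)).
Proof.
move=> cA cv; rewrite /qform.
by have [] := mcontM (mcontM (mcont_adj cv) cA) cv 0 0.
Qed.

Lemma closed_mx_eq p q (f g : X -> 'M[C]_(p, q)) :
  mcont f -> mcont g -> closed [set x | f x = g x].
Proof.
move=> cf cg.
have -> : [set x | f x = g x] = [set x | forall i j,
    complex.Re ((f x - g x) i j) = 0 /\ complex.Im ((f x - g x) i j) = 0].
  apply/seteqP; split=> x /= E; first by move=> i j; rewrite E !mxE subrr.
  apply/subr0_eq/matrixP=> i j; rewrite [RHS]mxE.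
  by apply: complex_eqP; case: (E i j).
apply: closed_forall => i; apply: closed_forall => j.
have c : ccont (fun x => (f x - g x) i j).
  have := mcontD cf (mcontZ (ccont_cst (-1)) cg) i j.
  by under [X in ccont X -> _]eq_fun do rewrite scaleN1r.
case: c => cr ci.
apply: (@closedI _ [set x | complex.Re ((f x - g x) i j) = 0]
  [set x | complex.Im ((f x - g x) i j) = 0]).
- by apply: (closed_preimage (D := [set y : R | y = 0]) cr); exact: closed_eq.
- by apply: (closed_preimage (D := [set y : R | y = 0]) ci); exact: closed_eq.
Qed.

(** One matrix equation and one weak inequality for each fixed v, all of them closed conditions on
    x. *)
Lemma closed_psd p (f : X -> 'M[C]_p) : mcont f -> closed [set x | psdmx (f x)].
Proof.
move=> cf; have -> : [set x | psdmx (f x)] = [set x | adjmx (f x) = f x] `&`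
    [set x | forall v, 0 <= qform (f x) v].
  by apply/seteqP; split=> x /psdmxE.
apply: closedI; first exact: (closed_mx_eq (mcont_adj cf) cf).
apply: closed_forall => v.
have c := qform_continuous cf (mcont_cst v).
exact: (closed_preimage (D := [set y : R | 0 <= y]) c (@closed_ge R 0)).
Qed.

End ComplexContinuity.

(** * Real coordinates and the unit sphere *)

Section RealCoordinates.
Variable R : realType.
Local Notation C := (R[i]).

Definition complexify p q (t : 'M[R]_(p, q + q)) : 'M[C]_(p, q) :=
  \matrix_(i, j) (t i (lshift q j) +i* t i (rshift q j)).

Lemma realifyK p q : cancel (@realify R p q) (@complexify p q).
Proof.
move=> A; apply/matrixP => i j; rewrite mxE row_mxEl row_mxEr !mxE.
by case: (A i j).
Qed.

Lemma complexifyK p q : cancel (@complexify p q) (@realify R p q).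
Proof.
move=> t; apply/matrixP => i j.
by case: (split_ordP j) => k ->; rewrite ?row_mxEl ?row_mxEr !mxE.
Qed.

Lemma realify_image p q (S : set 'M[C]_(p, q)) :
  (@realify R p q) @` S = [set t | S (complexify t)].
Proof.
apply/seteqP; split=> [_ [A SA <-]|t St] /=; first by rewrite realifyK.
by exists (complexify t) => //; rewrite complexifyK.
Qed.

Lemma realifyD p q (A B : 'M[C]_(p, q)) :
  realify (A + B) = realify A + realify B.
Proof.
by rewrite /realify add_row_mx; congr row_mx; apply/matrixP => i j;
  rewrite !mxE ?RecD ?ImcD.
Qed.

Lemma realifyZ p q (r : R) (A : 'M[C]_(p, q)) :
  realify (r%:C *: A) = r *: realify A.
Proof.
rewrite /realify scale_row_mx; congr row_mx; apply/matrixP => i j;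
  rewrite !mxE ?RecM ?ImcM /=; ring.
Qed.

Lemma mcont_complexify (X : topologicalType) p q (f : X -> 'M[R]_(p, q + q)) :
  continuous f -> mcont (fun x => complexify (f x)).
Proof.
move=> cf i j; have c k : continuous (fun x => f x i k).
  move=> x; exact: (@continuous_comp _ _ _ f (fun t : 'M[R]_(p, q + q) => t i k)
    x (cf x) (@coord_continuous R _ _ i k (f x))).
by split; under eq_fun do rewrite mxE /=; exact: c.
Qed.

Lemma ccont_real (X : topologicalType) (f : X -> R) :
  continuous f -> ccont (fun x => (f x)%:C).
Proof. by move=> cf; split=> //= x; exact: cvg_cst. Qed.

(** Heine-Borel, transported along [realify]. *)
Lemma complexify_bounded_compact p q (S : set 'M[C]_(p, q)) (B : R) :
  (forall A, S A -> forall i j,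
     `|complex.Re (A i j)| <= B /\ `|complex.Im (A i j)| <= B) ->
  closed [set t | S (complexify t)] -> ccompact S.
Proof.
move=> SB cS; rewrite /ccompact realify_image.
apply: (closed_bounded_mx_compact (B := B)) => // t St i j.
case: (split_ordP j) => k ->.
- by have [+ _] := SB _ St i k; rewrite mxE.
- by have [_ +] := SB _ St i k; rewrite mxE.
Qed.

(** This is the sphere of the max-norm, in the real coordinates of a complex column vector; what
    matters is that it is compact and meets every ray. *)
Definition sphere p : set 'M[R]_(p, 1 + 1) := [set w | `|w| = 1].

Lemma compact_sphere p : compact (@sphere p).
Proof.
apply: (closed_bounded_mx_compact (B := 1)).
  move=> t t1 i j; rewrite -t1 [leRHS]/Num.norm /= mx_normrE.
  by apply/bigmax_geP; right => /=; exists (i, j).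
exact: (closed_preimage (D := [set y : R | y = 1]) (@norm_continuous R _)
  (@closed_eq R 1)).
Qed.

(** [qform A] is homogeneous of degree two, so its sign at a nonzero v is its sign at the positive
    multiple of v of norm one. *)
Lemma sphere_pd p (A : 'M[C]_p) : adjmx A = A ->
  (pdmx A <-> forall w, sphere w -> 0 < qform A (complexify w)).
Proof.
move=> hA; split=> [[_ pA] w w1|pA].
  apply: pA; apply/eqP => w0; have : w = 0.
    by rewrite -[w]complexifyK w0; apply/matrixP => i j;
      case: (split_ordP j) => k ->;
      rewrite ?row_mxEl ?row_mxEr !mxE.
  move=> w00; move: w1; rewrite /sphere /= w00 normr0 => /esym/eqP.
  by rewrite oner_eq0.
split=> // v v0; have nv : 0 < `|realify v|.
  rewrite normr_gt0; apply: contra v0 => /eqP v0.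
  by rewrite -[v]realifyK v0; apply/eqP/matrixP => i j; rewrite !mxE.
pose w := `|realify v|^-1%:C *: v.
have := pA (realify w); rewrite realifyK /w qformZv /= => /(_ _)/wrap[].
  by rewrite /sphere /= realifyZ normrZ ger0_norm ?invr_ge0 ?mulVf ?gt_eqF // ltW.
by rewrite expr0n /= addr0 pmulr_rgt0 // exprn_gt0 ?invr_gt0.
Qed.

(** The tube lemma over the compact sphere turns an open condition for each vector into an open
    condition for all at once. *)
Lemma open_pd (X : topologicalType) p (f : X -> 'M[C]_p) : mcont f ->
  open [set x | forall w, sphere w -> 0 < qform (f x) (complexify w)].
Proof.
move=> cf; apply: (open_forall_compact (G := [set wx |
  0 < qform (f wx.2) (complexify wx.1)]) (@compact_sphere p)).
suff c : continuous (fun wx : 'M[R]_(p, 1 + 1) * X =>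
    qform (f wx.2) (complexify wx.1)).
  exact: (open_preimage (D := [set y : R | 0 < y]) c (@open_gt R 0)).
apply: qform_continuous; last by apply: mcont_complexify => x; exact: cvg_fst.
move=> i j; have [a b] := cf i j; split=> x.
- exact: (@continuous_comp _ _ _ snd (fun y => complex.Re (f y i j)) x cvg_snd
    (a x.2)).
- exact: (@continuous_comp _ _ _ snd (fun y => complex.Im (f y i j)) x cvg_snd
    (b x.2)).
Qed.

(** Positive definiteness is open along the line A + e H, so it holds on a ball around e = 0, which
    contains both signs of a small e. *)
Lemma pd_perturb p (A H : 'M[C]_p) : pdmx A -> adjmx H = H ->
  exists2 e : R, 0 < e & pdmx (A + e%:C *: H) /\ pdmx (A - e%:C *: H).
Proof.
move=> pA hH; have hA := pA.1.
have herm (e : R) : adjmx (A + e%:C *: H) = A + e%:C *: H.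
  by rewrite adjmxD adjmxZr hA hH.
have : nbhs (0 : R) [set e : R | pdmx (A + e%:C *: H)].
  pose f (e : R) := A + e%:C *: H.
  have cf : mcont f.
    apply: mcontD; first exact: mcont_cst.
    apply: mcontZ; last exact: mcont_cst.
    by apply: ccont_real => x; exact: cvg_id.
  have f0 : forall w, sphere w -> 0 < qform (f 0) (complexify w).
    by rewrite /f scale0r addr0; apply/sphere_pd.
  have := open_nbhs_nbhs (conj (open_pd cf) f0).
  by apply: filterS => e /= pe; apply/sphere_pd.
move=> /nbhs_ballP[d /= d0 dP]; exists (d / 2); first by rewrite divr_gt0.
have d2 : `|d / 2| < d by rewrite gtr0_norm ?divr_gt0 // gtr_pMr // invf_lt1 ?ltr1n.
split; first by apply: dP; rewrite /ball /= sub0r normrN.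
have /= := dP (- (d / 2)); rewrite rmorphN scaleNr; apply.
by rewrite /ball /= sub0r opprK.
Qed.

End RealCoordinates.

(** * Linear maps in matrix form *)

Section MapActions.
Variable R : realType.
Local Notation C := (R[i]).
Variables n m : nat.
Implicit Types T S : 'M[C]_(n * n, m * m).
Implicit Types X Y : 'M[C]_n.

Lemma app_addl T S X : app (T + S) X = app T X + app S X.
Proof. by rewrite /app mulmxDr linearD. Qed.

Lemma app_scalel a T X : app (a *: T) X = a *: app T X.
Proof. by rewrite /app -scalemxAr linearZ. Qed.

Lemma app_addr T X Y : app T (X + Y) = app T X + app T Y.
Proof. by rewrite /app linearD mulmxDl linearD. Qed.

Lemma app_scaler a T X : app T (a *: X) = a *: app T X.
Proof. by rewrite /app linearZ -scalemxAl linearZ. Qed.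

Lemma app_oppr T X : app T (- X) = - app T X.
Proof. by rewrite -scaleN1r app_scaler scaleN1r. Qed.

Lemma app_comp k (T : 'M[C]_(k * k, n * n)) S (X : 'M[C]_k) :
  app (T *m S) X = app S (app T X).
Proof. by rewrite /app vec_mxK mulmxA. Qed.

(** Rank-one maps are the building blocks of all the witnesses below: a Hermitian G and a traceless
    Hermitian Z give directions along which HPTP is kept. *)
Definition rk1_fun (G : 'M[C]_n) (Z : 'M[C]_m) X : 'M[C]_m := \tr (G *m X) *: Z.

Fact rk1_fun_linear G Z : linear (rk1_fun G Z).
Proof.
move=> a X Y; rewrite /rk1_fun mulmxDr -scalemxAr linearD linearZ /=.
by rewrite scalerDl scalerA.
Qed.

HB.instance Definition _ G Z := GRing.isLinear.Build _ _ _ _ (rk1_fun G Z)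
  (rk1_fun_linear G Z).

Definition rk1map (G : 'M[C]_n) (Z : 'M[C]_m) : 'M[C]_(n * n, m * m) :=
  lin_mx (rk1_fun G Z).

Lemma app_rk1map G Z X : app (rk1map G Z) X = \tr (G *m X) *: Z.
Proof. by rewrite /app mul_vec_lin mxvecK. Qed.

(** For a density D this is the constant channel with output D. *)
Definition trmap (D : 'M[C]_m) : 'M[C]_(n * n, m * m) := rk1map 1%:M D.

Lemma app_trmap D X : app (trmap D) X = \tr X *: D.
Proof. by rewrite app_rk1map mul1mx. Qed.

Lemma HermPresD T S : HermPres T -> HermPres S -> HermPres (T + S).
Proof. by move=> hT hS X; rewrite !app_addl adjmxD hT hS. Qed.

Lemma HermPresZ (r : R) T : HermPres T -> HermPres (r%:C *: T).
Proof. by move=> hT X; rewrite !app_scalel adjmxZr hT. Qed.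

Lemma HermPres_rk1 G Z : adjmx G = G -> adjmx Z = Z -> HermPres (rk1map G Z).
Proof.
move=> hG hZ X; rewrite !app_rk1map adjmxZ hZ -mxtrace_adj adjmxM hG.
by rewrite mxtrace_mulC.
Qed.

Lemma HermPres_app T X : HermPres T -> adjmx X = X ->
  adjmx (app T X) = app T X.
Proof. by move=> hT hX; rewrite -hT hX. Qed.

Lemma HPset_trmap D : adjmx D = D -> \tr D = 1 -> HPset R n m (trmap D).
Proof.
move=> hD tD; split; first by apply: HermPres_rk1; rewrite ?adjmx1.
by move=> X; rewrite app_trmap linearZ /= tD mulr1.
Qed.

(** HPTP maps form an affine space whose directions are the Hermitian-preserving maps with traceless
    values. *)
Lemma HPset_perturb T S (e : R) : HPset R n m T -> HermPres S ->
  (forall X, \tr (app S X) = 0) -> HPset R n m (T + e%:C *: S).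
Proof.
move=> [hT tT] hS tS; split; first exact/HermPresD/HermPresZ.
by move=> X; rewrite app_addl app_scalel linearD linearZ /= tT tS mulr0 addr0.
Qed.

Lemma HPset_segment T S : HPset R n m T -> HPset R n m S ->
  segment_in (HPset R n m) S T.
Proof.
move=> [hT tT] [hS tS] l _; split; first by apply: HermPresD; exact: HermPresZ.
move=> X; rewrite app_addl !app_scalel linearD !linearZ /= tT tS -mulrDl.
by rewrite -rmorphD /= addrC subrK mul1r.
Qed.

Lemma qform_segment T S X v (l : R) :
  qform (app (l%:C *: T + (1 - l)%:C *: S) X) v =
  l * qform (app T X) v + (1 - l) * qform (app S X) v.
Proof. by rewrite app_addl !app_scalel qformD !qformZ. Qed.

End MapActions.

(** * Traces and density matrices *)

Section TraceFacts.
Variable R : realType.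
Local Notation C := (R[i]).

Lemma hermitian_trace_real p (A : 'M[C]_p) : adjmx A = A ->
  \tr A = (complex.Re (\tr A))%:C.
Proof.
move=> hA; apply: complex_eqP => //=.
have /(congr1 (@complex.Im R)) := mxtrace_adj A; rewrite hA Imc_conj => ?.
lra.
Qed.

Lemma pd_diag_gt0 p (A : 'M[C]_p) i : pdmx A -> 0 < complex.Re (A i i).
Proof.
move=> pA; have := pA.2 (delta_mx i 0); rewrite /qform.
have -> : adjmx (delta_mx i 0 : 'cV[C]_p) = delta_mx 0 i.
  by apply/matrixP => a b; rewrite !mxE andbC conjc_nat.
rewrite -rowE -colE !mxE; apply; apply/eqP => /matrixP/(_ i 0)/eqP.
by rewrite !mxE !eqxx oner_eq0.
Qed.

Lemma pd_trace_gt0 p (A : 'M[C]_p) : (0 < p)%N -> pdmx A ->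
  0 < complex.Re (\tr A).
Proof.
move=> p0 pA; apply: lt_le_trans (psd_diag_le_trace (Ordinal p0) (pdmx_psd pA)).
exact: pd_diag_gt0.
Qed.

Lemma normalize_density p (A : 'M[C]_p) : (0 < p)%N -> pdmx A ->
  exists2 r : R, 0 < r & density (r%:C *: A) /\ pdmx (r%:C *: A).
Proof.
move=> p0 pA; have t0 := pd_trace_gt0 p0 pA.
exists (complex.Re (\tr A))^-1; first by rewrite invr_gt0.
have pdA : pdmx ((complex.Re (\tr A))^-1%:C *: A) by apply: pdmxZ; rewrite ?invr_gt0.
split=> //; split; first exact: pdmx_psd.
rewrite linearZ /= [X in _ * X]hermitian_trace_real ?pA.1 //.
by rewrite -rmorphM mulVf ?gt_eqF.
Qed.

(** Makes the form at v a trace functional, so that composing a map with [rk1map (v *m adjmx v) Z]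
    evaluates the form of its Hermitian values at v. *)
Lemma tr_outer p (A : 'M[C]_p) (v : 'cV[C]_p) : adjmx A = A ->
  \tr (v *m adjmx v *m A) = (qform A v)%:C.
Proof.
move=> hA; rewrite -mulmxA mxtrace_mulC trace_mx11.
by apply: complex_eqP => //=; rewrite hermitian_form_real.
Qed.

Lemma outer_psd p (v : 'cV[C]_p) : psdmx (v *m adjmx v).
Proof.
have := psd_conj (adjmx v) (pdmx_psd (pdmx1 R 1)).
by rewrite adjmxK mulmx1.
Qed.

Lemma delta_psd p (i : 'I_p) : psdmx (delta_mx i i : 'M[C]_p).
Proof.
have := outer_psd (delta_mx i 0 : 'cV[C]_p); congr psdmx.
apply/matrixP => a b; rewrite mxE big_ord1 !mxE eqxx !andbT conjc_nat.
by rewrite -natrM mulnb.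
Qed.

Lemma tr_delta p (i : 'I_p) : \tr (delta_mx i i : 'M[C]_p) = 1.
Proof.
rewrite /mxtrace (bigD1 i) //= mxE eqxx big1 ?addr0 // => j /negbTE ji.
by rewrite mxE ji.
Qed.

Lemma unit_density p : (0 < p)%N ->
  density ((p%:R^-1 : R)%:C *: (1%:M : 'M[C]_p)) /\
  pdmx ((p%:R^-1 : R)%:C *: (1%:M : 'M[C]_p)).
Proof.
move=> p0; have pd : pdmx ((p%:R^-1 : R)%:C *: (1%:M : 'M[C]_p)).
  by apply: pdmxZ (pdmx1 _ _); rewrite invr_gt0 ltr0n.
split=> //; split; first exact: pdmx_psd.
rewrite linearZ /= mxtrace1 -(rmorph_nat (real_complex R)) -rmorphM mulVf //.
by rewrite pnatr_eq0 -lt0n.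
Qed.

End TraceFacts.

(** * Semi-positivity criteria and mixing with positive maps *)

Section SemiPositivity.
Variable R : realType.
Local Notation C := (R[i]).
Variables n m : nat.
Implicit Types T S c x : 'M[C]_(n * n, m * m).

(** Trace preservation fixes the trace of the output, and [pdmxE] absorbs invertibility. *)
Lemma SP_mapP T : TracePres T -> SP_map T <->
  exists rho : 'M[C]_n, [/\ density rho, pdmx rho & pdmx (app T rho)].
Proof.
move=> tT; split=> [[rho [d u dT uT]]|[rho [d pd pdT]]]; exists rho.
  by split=> //; apply/pdmxE; split=> //; [case: d|case: dT].
have [ps u] := (pdmxE rho).1 pd; have [psT uT] := (pdmxE (app T rho)).1 pdT.
by split=> //; split=> //; rewrite tT; case: d.
Qed.

Lemma SN_mapP T : TracePres T -> SN_map T <->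
  exists2 rho : 'M[C]_n, density rho & psdmx (app T rho).
Proof.
move=> tT; split=> [[rho [d [psT _]]]|[rho d psT]]; exists rho => //.
by split=> //; split=> //; rewrite tT; case: d.
Qed.

(** Gram-Schmidt on a row base of A gives orthonormal rows; their transposes are the columns of
    V. *)
Lemma isometry_onto p (A : 'M[C]_p) : exists d (V : 'M[C]_(p, d)),
  adjmx V *m V = 1%:M /\ (V^T :=: A)%MS.
Proof.
pose B := row_base A; pose U := schmidt B.
have fB : row_free B := row_base_free A.
have /unitarymxP uU : U \is unitarymx.
  by apply: schmidt_unitarymx; exact: rank_leq_col.
exists (\rank A), U^T; split; last first.
  rewrite trmxK; apply: eqmx_trans (eq_row_base A).
  exact: eqmx_schmidt_free.
apply: trmx_inj; rewrite trmx1 -[RHS]uU trmx_mul trmxK; congr (_ *m _).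
by apply/matrixP => i j; rewrite !mxE.
Qed.

(** Row spaces are dual to kernels: the columns of [cokermx A] are killed by A, hence by B. *)
Lemma submx_kerP p (A B : 'M[C]_p) :
  (forall v : 'cV[C]_p, A *m v = 0 -> B *m v = 0) -> (B <= A)%MS.
Proof.
move=> AB; rewrite submxE; apply/eqP/trmx_inj/row_matrixP => i.
rewrite trmx0 row0 -tr_col; apply: trmx_inj; rewrite trmxK trmx0.
rewrite colE -mulmxA; apply: AB.
by rewrite mulmxA mulmx_coker mul0mx.
Qed.

(** Eliminates the isometry V. Forward, V V^* acts as the identity on both sides of every T a, so T
    rho = V S V^* with S positive definite, and a zero of its form is killed by V^*. Conversely, the
    kernel condition puts the range of each T a inside the range of T rho, onto which V can be
    chosen. *)
Lemma SPR_mapP T : HPset R n m T -> SPR_map T <->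
  exists rho : 'M[C]_n, [/\ density rho, pdmx rho, psdmx (app T rho) &
    forall v, qform (app T rho) v = 0 -> forall a, app T a *m v = 0].
Proof.
move=> [hT tT]; split.
  move=> [d [V [VV TV _ [rho [dr ur dS uS]]]]]; exists rho.
  have VT a : V *m adjmx V *m app T a = app T a.
    have /submxP[B TB] := TV a.
    have -> : app T a = V *m B^T by rewrite -[LHS]trmxK TB trmx_mul trmxK.
    by rewrite -!mulmxA (mulmxA (adjmx V)) VV mul1mx.
  (* The adjoint of [VT] at [adjmx a], turned around by Hermitian preservation. *)
  have TVV a : app T a *m (V *m adjmx V) = app T a.
    by rewrite -[RHS]adjmxK -hT -(VT (adjmx a)) hT !adjmxM !adjmxK.
  have pdr : pdmx rho by apply/pdmxE; split=> //; case: dr.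
  have TrE : app T rho = adjmx (adjmx V) *m (adjmx V *m app T rho *m V)
      *m adjmx V.
    by rewrite adjmxK !mulmxA VT -mulmxA TVV.
  split=> //; first by rewrite TrE; apply: psd_conj; case: dS.
  move=> v; rewrite TrE qform_conj => q0 a.
  have /pdmxE pdS : psdmx (adjmx V *m app T rho *m V) /\
      adjmx V *m app T rho *m V \in unitmx by split=> //; case: dS.
  have Vv : adjmx V *m v = 0.
    by apply/eqP/contraT => /pdS.2; rewrite q0 ltxx.
  by rewrite -TVV -!mulmxA Vv !mulmx0.
move=> [rho [dr pdr psT kT]].
have [d [V [VV VA]]] := isometry_onto (app T rho)^T.
have sub a : ((app T a)^T <= (app T rho)^T)%MS.
  apply: submx_kerP => w.
  (* Ranges are encoded by transposes; conjugation turns the kernel of a transpose into that of an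
     adjoint, and [hT] moves the adjoint to the argument. *)
  have cj (A : 'M[C]_m) (u : 'cV[C]_m) :
      A^T *m u = map_mx conjc (adjmx A *m map_mx conjc u).
    rewrite map_mxM; congr (_ *m _); apply/matrixP => i j;
      by rewrite !mxE /= conjcK.
  rewrite cj (psd_herm psT) => /(congr1 (map_mx conjc)).
  have -> : map_mx conjc (map_mx conjc (app T rho *m map_mx conjc w)) =
      app T rho *m map_mx conjc w by apply/matrixP => i j; rewrite !mxE conjcK.
  rewrite map_mx0 => /qform_ker/kT kw.
  by rewrite cj -hT kw map_mx0.
exists d, V; split=> //.
- by move=> a; rewrite VA.
- by move=> p W /(_ rho); rewrite VA.
have /submxP[B VB] : (V^T <= (app T rho)^T)%MS by rewrite VA.
(* V^* factors through T rho, which makes the compression injective: T rho V w = 0 gives w = V^* V w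
   = 0. *)
have {}VB : adjmx V = (map_mx conjc B) *m app T rho.
  have -> : V = app T rho *m B^T by rewrite -[LHS]trmxK VB trmx_mul trmxK.
  rewrite adjmxM (psd_herm psT); congr (_ *m _).
  by apply/matrixP => i j; rewrite !mxE.
have /submxP[E TE] : ((app T rho)^T <= V^T)%MS by rewrite VA.
(* V V^* fixes T rho, so the compression keeps the trace. *)
have {}TE : V *m (adjmx V *m app T rho) = app T rho.
  have -> : app T rho = V *m E^T by rewrite -[LHS]trmxK TE trmx_mul trmxK.
  by rewrite (mulmxA (adjmx V)) VV mul1mx.
have psS := psd_conj V psT.
have [_ ur] := (pdmxE rho).1 pdr.
exists rho; split=> //.
- by split=> //; rewrite mxtrace_mulC TE tT; case: dr.
- apply: unitmx_injP => w /qform_ker; rewrite qform_conj.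
  move=> /(psd_qform_eq0 psT) Aw.
  by rewrite -[w]mul1mx -VV -mulmxA VB -!mulmxA Aw !mulmx0.
Qed.

Lemma SP_SPR : SPset R n m `<=` SPRset R n m.
Proof.
move=> T [hT /(SP_mapP hT.2)[rho [d pd pdT]]]; split=> //.
apply/(SPR_mapP hT); exists rho; split=> //; first exact: pdmx_psd.
move=> v q0 a; suff -> : v = 0 by rewrite mulmx0.
by apply/eqP/contraT => /pdT.2; rewrite q0 ltxx.
Qed.

Lemma SPR_SN : SPRset R n m `<=` SNset R n m.
Proof.
move=> T [hT /(SPR_mapP hT)[rho [d _ psT _]]]; split=> //.
by apply/(SN_mapP hT.2); exists rho.
Qed.

(* Any Hermitian perturbation of rho is still psd for small coefficients of
   either sign, so v^* c(rho) v = 0 forces v^* c(H) v = 0. *)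
Lemma positive_ker c (rho : 'M[C]_n) v : positive_map c -> pdmx rho ->
  qform (app c rho) v = 0 -> forall a, app c a *m v = 0.
Proof.
move=> pc pd q0.
have psr := pc _ (pdmx_psd pd).
have H0 H : adjmx H = H -> app c H *m v = 0.
  move=> hH; have [e e0 [p1 p2]] := pd_perturb pd hH.
  have ps1 := pc _ (pdmx_psd p1); have ps2 := pc _ (pdmx_psd p2).
  have := psd_qform v ps1; have := psd_qform v ps2.
  rewrite !(app_addr, app_oppr) !app_scaler !qformD qformN qformZ q0 !add0r.
  rewrite oppr_ge0 => l1 l2.
  have E : e * qform (app c H) v = 0 by apply/le_anti; rewrite l1 l2.
  have := psd_qform_eq0 ps1 (v := v).
  rewrite app_addr app_scaler qformD qformZ q0 E addr0 mulmxDl => /(_ erefl).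
  rewrite (psd_qform_eq0 psr q0) add0r -scalemxAl => /eqP.
  by rewrite scaler_eq0 (inj_eq (@complexI R)) gt_eqF //= => /eqP.
move=> a; have [H [K [hH hK ->]]] := hermitian_decomp a.
by rewrite app_addr app_scaler mulmxDl -scalemxAl !H0 // scaler0 addr0.
Qed.

(** By [positive_ker] any invertible density is a witness; the maximally mixed one is taken. *)
Lemma P_SPR : (0 < n)%N -> Pset R n m `<=` SPRset R n m.
Proof.
move=> n0 c [hc pc]; split=> //; apply/(SPR_mapP hc).
have [d pd] := unit_density R n0; eexists; split; [exact: d|exact: pd| |].
  exact/pc/pdmx_psd.
by move=> v q0; exact: positive_ker q0.
Qed.

(** The witness of x serves every mixture, since c sends it to a psd matrix. *)
Lemma SN_star c : Pset R n m c -> forall x, SNset R n m x ->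
  segment_in (SNset R n m) c x.
Proof.
move=> [hc pc] x [hx /(SN_mapP hx.2)[rho d psx]] l /[dup] l01 /andP[l0 l1].
have hy := HPset_segment hx hc l01.
split; first exact: hy.
apply/(SN_mapP hy.2); exists rho; first exact: d.
rewrite app_addl !app_scalel; apply: psdD.
  exact: psdZ psx.
by apply: psdZ; [rewrite subr_ge0 | apply: pc; case: d].
Qed.

(** The witness rho of x serves again once c rho is positive definite: by [positive_ker] a zero v of
    its form is killed by c sig, where sig witnesses SP for c, so v = 0. *)
Lemma SP_star c : (SPset R n m `&` Pset R n m) c -> forall x, SPset R n m x ->
  segment_in (SPset R n m) c x.
Proof.
move=> [[hc /(SP_mapP hc.2)[sig [_ _ pdcs]]] [_ pc]] x.
move=> [hx /(SP_mapP hx.2)[rho [d pd pdx]]] l /[dup] l01 /andP[l0 l1].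
have hy := HPset_segment hx hc l01.
split; first exact: hy.
apply/(SP_mapP hy.2); exists rho; split; [exact: d|exact: pd|].
have pdcr : pdmx (app c rho).
  have psr := pc _ (pdmx_psd pd).
  split; first exact: psd_herm.
  move=> v v0; rewrite lt_def psd_qform // andbT; apply/eqP => q0.
  have := positive_ker pc pd q0 sig => /qform_ker E.
  by have := pdcs.2 _ v0; rewrite E ltxx.
split; first by apply: HermPres_app => //; [case: hy|case: pd].
move=> v v0; rewrite qform_segment.
have [->|ln0] := eqVneq l 0.
  by rewrite mul0r add0r subr0 mul1r; exact: pdcr.2.
apply: ltr_pwDl.
  by rewrite mulr_gt0 ?pdx.2 // lt_def ln0.
by rewrite mulr_ge0 ?subr_ge0 // ltW // pdcr.2.
Qed.

(** Strictly inside the segment a zero of the mixed form is a zero of both forms, so it is killed by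
    all x a and all c a. The endpoints are c and x themselves. *)
Lemma SPR_star c : (0 < n)%N -> Pset R n m c -> forall x, SPRset R n m x ->
  segment_in (SPRset R n m) c x.
Proof.
move=> n0 Pc; have [hc pc] := Pc.
move=> x Sx l /[dup] l01 /andP[l0 l1].
have [->|ln0] := eqVneq l 0.
  by rewrite scale0r add0r subr0 scale1r; exact: P_SPR.
have [->|ln1] := eqVneq l 1.
  by rewrite subrr scale0r addr0 scale1r.
have {ln0}l0 : 0 < l by rewrite lt_def ln0.
have {ln1}l1 : 0 < 1 - l by rewrite subr_gt0 lt_def eq_sym ln1.
have [hx /(SPR_mapP hx)[rho [d pd psx kx]]] := Sx.
have hy := HPset_segment hx hc l01.
split; first exact: hy.
apply/(SPR_mapP hy); exists rho.
have psc := pc _ (pdmx_psd pd).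
split; [exact: d|exact: pd| |].
  rewrite app_addl !app_scalel.
  exact: psdD (psdZ (ltW l0) psx) (psdZ (ltW l1) psc).
move=> v /eqP; rewrite qform_segment paddr_eq0.
2, 3: by rewrite mulr_ge0 ?psd_qform // ltW.
rewrite !mulf_eq0 (gt_eqF l0) (gt_eqF l1) /= => /andP[/eqP qx /eqP qc] a.
rewrite app_addl !app_scalel mulmxDl -!scalemxAl kx //.
by rewrite (positive_ker pc pd qc) !scaler0 addr0.
Qed.

Lemma not_positive_witness c : (0 < n)%N -> HPset R n m c -> ~ positive_map c ->
  exists (rho : 'M[C]_n) v, [/\ density rho, pdmx rho & qform (app c rho) v < 0].
Proof.
move=> n0 [hc tc] /existsNP[X /not_implyP[psX npsX]].
have hX := HermPres_app hc (psd_herm psX).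
have [v qv] : exists v, qform (app c X) v < 0.
  apply: contrapT => nv; apply: npsX; apply/psdmxE; split=> // v.
  by rewrite leNgt; apply/negP => qv; apply: nv; exists v.
set q := qform _ _ in qv; pose q1 := qform (app c 1%:M) v.
have d0 : 0 < `|q1| + 1 by rewrite ltr_wpDl.
(* Small enough that s |q1| < - q: adding s times the identity makes X invertible and keeps the form
   of its image negative at v. *)
pose s := - q / (`|q1| + 1).
have s0 : 0 < s by rewrite divr_gt0 ?oppr_gt0.
have pdX : pdmx (X + s%:C *: 1%:M) by apply: pdmxD => //; apply: pdmxZ (pdmx1 _ _).
have [r r0 [dr pdr]] := normalize_density n0 pdX.
exists (r%:C *: (X + s%:C *: 1%:M)), v; split; [exact: dr|exact: pdr|].
rewrite app_scaler app_addr app_scaler qformZ qformD qformZ -/q -/q1.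
rewrite (pmulr_rlt0 _ r0) addrC -ltrBrDr sub0r.
have <- : s * (`|q1| + 1) = - q by rewrite /s divfK // gt_eqF.
apply: (@le_lt_trans _ _ (s * `|q1|)); first by rewrite ler_pM2l // ler_norm.
by rewrite mulrDr mulr1 ltrDl.
Qed.

(* The witness is x(Y) = tr(Y) 1/m + M (g(Y) - g(rho) tr(Y)) Z, where
   g(Y) = v^* c(Y) v and v^* Z v < 0: the choice of M cancels g(Y) in
   v^* (l x + (1-l) c)(Y) v, leaving the negative constant g(rho) / 2. *)
Lemma not_positive_escape c : (0 < n)%N -> (1 < m)%N -> HPset R n m c ->
  ~ positive_map c -> exists x, SPset R n m x /\
    exists2 l : R, 0 <= l <= 1 &
      ~ SNset R n m (l%:C *: x + (1 - l)%:C *: c).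
Proof.
have arith (a b : R) : 0 < a -> b < 0 -> - b <= 2 * (a - b) by lra.
have cancel_g (a b k d e f : R) : a * (b + k * (d - e) * - f) + (1 - a) * d =
  a * (b - e) + e + (a * k * f - (1 - a)) * (e - d) by ring.
move=> n0 m1 hc npc; have [rho [v [dr pdr gneg]]] := not_positive_witness n0 hc npc.
set g := qform _ _ in gneg.
have m0 : (0 < m)%N by exact: ltnW.
have v0 : v != 0 by apply/eqP => v0; move: gneg; rewrite /g v0 qform0 ltxx.
have N0 := qform1_gt0 v0; set N := qform _ _ in N0.
have [[psD tD] pdD] := unit_density R m0; set D := _ *: _ in psD tD pdD.
have mR : 1 < m%:R :> R by rewrite ltr1n.
have mR0 : m%:R != 0 :> R by rewrite gt_eqF // (lt_trans ltr01).
(* Traceless since v v^* has trace N; its form at v is N^2/m - N^2, negative because m > 1. *)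
pose Z : 'M[C]_m := N%:C *: D - v *m adjmx v.
have hZ : adjmx Z = Z.
  by rewrite /Z adjmxD adjmxN adjmxZr (psd_herm psD) adjmxM adjmxK.
have tZ : \tr Z = 0.
  rewrite linearB linearZ /= tD mulr1 -[v *m adjmx v]mulmx1 tr_outer ?adjmx1 //.
  by rewrite subrr.
have qD : qform D v = m%:R^-1 * N by rewrite qformZ.
pose z := N ^+ 2 * (1 - m%:R^-1).
have z0 : 0 < z.
  by rewrite mulr_gt0 ?exprn_gt0 // subr_gt0 invf_lt1 // (lt_trans ltr01).
have qZ : qform Z v = - z.
  rewrite qformD qformN qformZ qD.
  have -> : qform (v *m adjmx v) v = N ^+ 2.
    have := qform_conj (adjmx v) 1%:M v; rewrite adjmxK mulmx1 => ->.
    have := hermitian_form_real v (adjmx1 R m); rewrite mulmx1 => I0.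
    by rewrite qform1E big_ord1 I0 expr0n addr0 /N /qform mulmx1.
  by rewrite /z; field.
pose w := m%:R^-1 * N - g.
have w0 : 0 < w.
  rewrite subr_gt0 (lt_trans gneg) // mulr_gt0 ?invr_gt0 //.
  exact: lt_trans ltr01 mR.
(* Solves l N/m + (1 - l) g = g/2, the value left after the cancellation. *)
pose l := - g / (2 * w).
have l0 : 0 < l by rewrite divr_gt0 ?oppr_gt0 // mulr_gt0.
have l1 : l <= 1.
  rewrite ler_pdivrMr ?mulr_gt0 // mul1r /w.
  have : 0 < m%:R^-1 * N by rewrite mulr_gt0 ?invr_gt0 // (lt_trans ltr01).
  by move=> /arith; exact.
pose M := (1 - l) / (l * z).
pose S := c *m rk1map (v *m adjmx v) Z + (- g)%:C *: trmap n Z.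
pose x := trmap n D + M%:C *: S.
have hv : adjmx (v *m adjmx v) = v *m adjmx v by rewrite adjmxM adjmxK.
have hS : HermPres S.
  apply: HermPresD; last by apply/HermPresZ/HermPres_rk1; rewrite ?adjmx1.
  by move=> X; rewrite !app_comp hc.1 (HermPres_rk1 hv hZ).
have tS X : \tr (app S X) = 0.
  rewrite app_addl app_scalel app_comp app_rk1map app_trmap linearD !linearZ /=.
  by rewrite tZ !mulr0 addr0.
have hx : HPset R n m x.
  apply: HPset_perturb hS tS.
  exact: HPset_trmap (psd_herm psD) tD.
have xE Y : density Y -> app x Y = D + (M * (qform (app c Y) v - g))%:C *: Z.
  move=> [psY tY]; rewrite /x /S app_addl app_scalel app_addl app_scalel app_comp.
  rewrite app_rk1map !app_trmap tY !scale1r tr_outer; last first.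
    by apply: HermPres_app (psd_herm psY); case: hc.
  by rewrite -scalerDl scalerA -rmorphD -rmorphM.
exists x; split.
  split; first exact: hx.
  apply/(SP_mapP hx.2); exists rho; split; [exact: dr|exact: pdr|].
  by rewrite (xE _ dr) -/g subrr mulr0 scale0r addr0.
exists l; first by rewrite l1 ltW.
move=> [hy /(SN_mapP hy.2)[Y dY /(psd_qform v)]].
rewrite qform_segment (xE _ dY) qformD qformZ qD qZ leNgt => /negP; apply.
set h := qform (app c Y) v.
have -> : l * (m%:R^-1 * N + M * (h - g) * - z) + (1 - l) * h = g / 2.
  have lw : l * w = - g / 2 by rewrite /l; field; rewrite gt_eqF.
  have lM : l * M * z = 1 - l by rewrite /M; field; rewrite !gt_eqF.
  have -> : l * (m%:R^-1 * N + M * (h - g) * - z) + (1 - l) * h =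
     l * w + g + (l * M * z - (1 - l)) * (g - h).
    exact: cancel_g.
  by rewrite lM lw subrr mul0r addr0; field.
by rewrite pmulr_llt0 // invr_gt0.
Qed.

End SemiPositivity.

(** * Closedness, compactness and convexity *)

Section ClosednessCompactness.
Variable R : realType.
Local Notation C := (R[i]).
Variables n m : nat.

Lemma mcont_trace (X : topologicalType) p (f : X -> 'M[C]_p) :
  mcont f -> ccont (fun x => \tr (f x)).
Proof. by move=> cf; apply: ccont_sum => i; exact: cf. Qed.

Lemma mcont_const_mx (X : topologicalType) (f : X -> C) p q : ccont f ->
  mcont (fun x => const_mx (f x) : 'M[C]_(p, q)).
Proof. by move=> cf i j; under eq_fun do rewrite mxE. Qed.

Lemma mcont_complexify_id p q : mcont (fun t : 'M[R]_(p, q + q) => complexify t).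
Proof. by apply: mcont_complexify => x; exact: cvg_id. Qed.

Lemma closed_trace_eq (X : topologicalType) p (f : X -> 'M[C]_p) (c : C) :
  mcont f -> closed [set x | \tr (f x) = c].
Proof.
(* The scalar equation is treated as an equation of 1 by 1 matrices. *)
move=> cf; have := closed_mx_eq (mcont_const_mx (p := 1) (q := 1) (mcont_trace cf))
  (mcont_cst _ (const_mx c)).
congr closed; apply/seteqP; split=> x /= => [/matrixP/(_ 0 0)|->//].
by rewrite !mxE.
Qed.

Lemma closed_HP : closed [set t | HPset R n m (complexify t)].
Proof.
apply: closedI; apply: closed_forall => X.
- apply: closed_mx_eq; last apply: mcont_adj;
    by apply: mcont_app; [exact: mcont_complexify_id|exact: mcont_cst].
- apply: closed_trace_eq.
  by apply: mcont_app; [exact: mcont_complexify_id|exact: mcont_cst].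
Qed.

Lemma closed_P : closed [set t | Pset R n m (complexify t)].
Proof.
apply: closedI; first exact: closed_HP.
apply: closed_forall => X; apply: closed_forall => _; apply: closed_psd.
by apply: mcont_app; [exact: mcont_complexify_id|exact: mcont_cst].
Qed.

Lemma mcont_ampl (Y : topologicalType) k (T : Y -> 'M[C]_(n * n, m * m))
    (X : 'M[C]_(k * n)) : mcont T -> mcont (fun y => ampl (T y) X).
Proof.
move=> cT r s; under eq_fun do rewrite mxE.
do 4! (apply: ccont_sum => ?); apply: ccontM; first exact: ccont_cst.
by apply: mcont_app; [exact: cT|exact: mcont_cst].
Qed.

Lemma closed_CP : closed [set t | CPset R n m (complexify t)].
Proof.
apply: closedI; first exact: closed_HP.
apply: closed_forall => k; apply: closed_forall => X; apply: closed_forall => _.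
by apply: closed_psd; apply: mcont_ampl; exact: mcont_complexify_id.
Qed.

Lemma closed_density p : closed [set t | @density R p (complexify t)].
Proof.
apply: closedI; first by apply: closed_psd; exact: mcont_complexify_id.
by apply: closed_trace_eq; exact: mcont_complexify_id.
Qed.

Lemma compact_density p : ccompact [set A | @density R p A].
Proof.
apply: (complexify_bounded_compact (B := 1)); last exact: closed_density.
by move=> A [psA tA] i j; have := psd_entry_bound i j psA; rewrite tA.
Qed.

(** For Hermitian H some P = 1 + e H is psd. Then T P and T 1 are psd with traces independent of T,
    which bounds their entries, and H = (P - 1)/e. A general a is split into Hermitian parts. *)
Lemma positive_image_bound (a : 'M[C]_n) : exists B : R,
  forall T, Pset R n m T -> forall i j,
  `|complex.Re (app T a i j)| <= B /\ `|complex.Im (app T a i j)| <= B.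
Proof.
have hermB (H : 'M[C]_n) : adjmx H = H -> exists B : R,
    forall T, Pset R n m T -> forall i j,
    `|complex.Re (app T H i j)| <= B /\ `|complex.Im (app T H i j)| <= B.
  move=> hH; have [e e0 [pe _]] := pd_perturb (pdmx1 R n) hH.
  set P := _ + _ in pe; have ps1 := pdmx_psd (pdmx1 R n).
  exists (e^-1 * (complex.Re (\tr P) + complex.Re (\tr (1%:M : 'M[C]_n)))).
  move=> T [[_ tT] pT] i j.
  have [r1 i1] := psd_entry_bound i j (pT _ (pdmx_psd pe)).
  have [r2 i2] := psd_entry_bound i j (pT _ ps1).
  have HE : H = e^-1%:C *: (P + - 1%:M).
    by rewrite /P addrC addKr scalerA -rmorphM mulVf ?scale1r // gt_eqF.
  rewrite !tT in r1 i1 r2 i2.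
  have NE (x : C) : complex.Re (- x) = - complex.Re x /\
      complex.Im (- x) = - complex.Im x by case: x.
  have ImcZ (r : R) (x : C) : complex.Im (r%:C * x) = r * complex.Im x.
    by rewrite ImcM /= mul0r addr0.
  have ei : 0 < e^-1 by rewrite invr_gt0.
  rewrite HE app_scaler app_addr app_oppr.
  have EE (A B : 'M[C]_m) : (e^-1%:C *: (A + - B)) i j =
      e^-1%:C * (A i j + - B i j) by rewrite !mxE.
  rewrite EE RecZ ImcZ RecD ImcD (NE _).1 (NE _).2 !normrM (gtr0_norm ei).
  rewrite !(ler_pM2l ei).
  by split; apply: (le_trans (ler_normB _ _)); apply: lerD.
have [H [K [hH hK ->]]] := hermitian_decomp a.
have [B HB] := hermB _ hH; have [B' KB] := hermB _ hK.
exists (B + B') => T PT i j; have [r1 i1] := HB T PT i j.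
have [r2 i2] := KB T PT i j.
have EE (A A' : 'M[C]_m) : (A + 'i *: A') i j = A i j + 'i * A' i j.
  by rewrite !mxE.
rewrite app_addr app_scaler EE RecD ImcD RecM ImcM /= !mul0r !mul1r sub0r add0r.
split; apply: (le_trans (ler_normD _ _)); apply: lerD => //.
by rewrite normrN.
Qed.

Lemma P_bounded : exists B : R, forall T, Pset R n m T -> forall i j,
  `|complex.Re (T i j)| <= B /\ `|complex.Im (T i j)| <= B.
Proof.
have [B HB] := choice positive_image_bound.
(* Row k of T is the vectorized image of the k-th matrix unit, so finitely many of the chosen bounds
   suffice. *)
pose b (k : 'I_(n * n)) := B (vec_mx (delta_mx 0 k)).
exists (\sum_k `|b k|) => T PT k; case/mxvec_indexP => i j.
have TE : T k (mxvec_index i j) = app T (vec_mx (delta_mx 0 k)) i j.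
  by rewrite /app vec_mxK -rowE !mxE.
have bk : b k <= \sum_k `|b k|.
  by rewrite (bigD1 k) //= ler_wpDr ?sumr_ge0 // ler_norm.
have [r i0] := HB (vec_mx (delta_mx 0 k)) T PT i j.
by rewrite TE; split; apply: le_trans bk.
Qed.

Lemma compact_P : ccompact (Pset R n m).
Proof.
have [B HB] := P_bounded.
exact: (complexify_bounded_compact HB closed_P).
Qed.

(** [mxvec_index] is injective, so one term of the fourfold sum survives. *)
Lemma amplE k (T : 'M[C]_(n * n, m * m)) (X : 'M[C]_(k * n)) a b i j :
  ampl T X (mxvec_index a i) (mxvec_index b j) = app T (blk a b X) i j.
Proof.
have inj (x y : 'I_k) (u w : 'I_m) :
    (mxvec_index x u == mxvec_index y w) = (x == y) && (u == w).
  by rewrite /mxvec_index (inj_eq (@cast_ord_inj _ _ _)) (inj_eq enum_rank_inj).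
rewrite mxE (bigD1 a) //= (bigD1 b) //= (bigD1 i) //= (bigD1 j) //=.
rewrite !eqxx mul1r !big1 ?addr0 //.
- move=> a' na; rewrite !big1 // => *; rewrite !big1 // => *; rewrite !big1 // => *.
  by rewrite inj eq_sym (negbTE na) mul0r.
- move=> b' nb; rewrite !big1 // => *; rewrite !big1 // => *.
  by rewrite !inj (eq_sym b) (negbTE nb) andbF mul0r.
- move=> i' ni; rewrite !big1 // => *.
  by rewrite !inj (eq_sym i) (negbTE ni) andbF mul0r.
- move=> j' nj.
  by rewrite !inj (eq_sym j) (negbTE nj) !andbF mul0r.
Qed.

(** This is complete positivity at k = 1, up to identifying C^p with its tensor product with C^1. *)
Lemma CP_P : CPset R n m `<=` Pset R n m.
Proof.
move=> T [hT cpT]; split=> // X psX.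
(* Permutation matrix of this identification: conjugating by it carries X to a matrix whose only
   block is X. *)
pose J p : 'M[C]_(p, 1 * p) := \matrix_(i, r) (r == mxvec_index 0 i)%:R.
have inj p (u w : 'I_p) :
    (mxvec_index (0 : 'I_1) u == mxvec_index 0 w) = (u == w).
  by rewrite /mxvec_index (inj_eq (@cast_ord_inj _ _ _)) (inj_eq enum_rank_inj).
have JE p q (A : 'M[C]_(p, q)) r j : (A *m J q) r (mxvec_index 0 j) = A r j.
  rewrite mxE (bigD1 j) //= mxE eqxx mulr1 big1 ?addr0 // => k kj.
  by rewrite mxE inj eq_sym (negbTE kj) mulr0.
have psY := cpT 1 _ (psd_conj (J n) psX).
set Y := _ *m _ in psY.
have YX : blk 0 0 Y = X.
  apply/matrixP => i j; rewrite mxE JE -[LHS]conjcK.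
  have -> : (adjmx (J n) *m X) (mxvec_index 0 i) j =
      conjc ((adjmx X *m J n) j (mxvec_index 0 i)).
    by rewrite -[X in LHS]adjmxK -adjmxM !mxE.
  by rewrite JE conjcK mxE mxE conjcK.
have := psd_conj (adjmx (J m)) psY; rewrite adjmxK; congr psdmx.
apply/matrixP => i j; rewrite -YX -amplE.
have JE' q (A : 'M[C]_(1 * m, q)) r k : (J m *m A) r k = A (mxvec_index 0 r) k.
  rewrite mxE (bigD1 (mxvec_index 0 r)) //= mxE eqxx mul1r big1 ?addr0 // => s sr.
  by rewrite mxE (negbTE sr) mul0r.
rewrite -mulmxA JE' -[LHS]conjcK.
have -> : conjc ((ampl T Y *m adjmx (J m)) (mxvec_index 0 i) j) =
    (J m *m adjmx (ampl T Y)) j (mxvec_index 0 i).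
  by rewrite -[J m in RHS]adjmxK -adjmxM !mxE.
by rewrite JE' !mxE conjcK.
Qed.

Lemma compact_CP : ccompact (CPset R n m).
Proof.
have [B HB] := P_bounded.
apply: (complexify_bounded_compact (B := B)); last exact: closed_CP.
by move=> T /CP_P; exact: HB.
Qed.

Lemma convex_P : cconvex (Pset R n m).
Proof.
move=> T S [hT pT] [hS pS] l /[dup] l01 /andP[l0 l1].
split; first exact: HPset_segment.
move=> X psX; rewrite app_addl !app_scalel.
apply: psdD; apply: psdZ; rewrite ?subr_ge0 //; [exact: pT|exact: pS].
Qed.

Lemma ampl_segment k (T S : 'M[C]_(n * n, m * m)) (X : 'M[C]_(k * n)) a b :
  ampl (a *: T + b *: S) X = a *: ampl T X + b *: ampl S X.
Proof.
apply/matrixP => r s; case/mxvec_indexP: r => x i; case/mxvec_indexP: s => y j.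
rewrite amplE app_addl !app_scalel.
by rewrite [LHS]mxE [RHS]mxE; congr (_ + _); rewrite [LHS]mxE [RHS]mxE amplE.
Qed.

Lemma convex_CP : cconvex (CPset R n m).
Proof.
move=> T S [hT pT] [hS pS] l /[dup] l01 /andP[l0 l1].
split; first exact: HPset_segment.
move=> k X psX; rewrite ampl_segment.
apply: psdD; apply: psdZ; rewrite ?subr_ge0 //; [exact: pT|exact: pS].
Qed.

(** For a fixed rho the condition is open by [open_pd]; a union over rho follows. *)
Lemma open_SP : open_in (HPset R n m) (SPset R n m).
Proof.
split; first by move=> T [].
(* Only the form is constrained here; the Hermitian symmetry in [pdmx] comes back from HP. *)
exists [set t | exists2 rho : 'M[C]_n, density rho /\ pdmx rho &
  forall w, sphere w -> 0 < qform (app (complexify t) rho) (complexify w)].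
split.
  rewrite (_ : [set t | _] = \bigcup_(rho in [set rho : 'M[C]_n |
    density rho /\ pdmx rho]) [set t | forall w, sphere w ->
    0 < qform (app (complexify t) rho) (complexify w)]) //.
  apply: bigcup_open => rho _; apply: open_pd.
  by apply: mcont_app; [exact: mcont_complexify_id|exact: mcont_cst].
apply/seteqP; split=> T [hT] /=; rewrite realifyK.
  move=> /(SP_mapP hT.2)[rho [d pd pdT]]; split; first exact: hT.
  by exists rho => //; apply/sphere_pd => //; case: pdT.
move=> [rho [d pd] sT]; split; first exact: hT.
apply/(SP_mapP hT.2); exists rho; split; [exact: d|exact: pd|].
apply/sphere_pd => //; apply: HermPres_app; [exact: hT.1|exact: pd.1].
Qed.

(** The pairs (rho, T) with T rho psd form a closed set, which is projected along the compact set of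
    densities. *)
Lemma closed_SN : closed_in (HPset R n m) (SNset R n m).
Proof.
split; first by move=> T [].
exists [set t | exists r, ((@realify R n n) @` [set A | density A]) r /\
  [set rt | psdmx (app (complexify rt.2) (complexify rt.1))] (r, t)].
split.
  apply: closed_exists_compact; first exact: compact_density.
  apply: closed_psd; apply: mcont_app; apply: mcont_complexify => x.
    exact: cvg_snd.
  exact: cvg_fst.
apply/seteqP; split=> T [hT] /=; rewrite realifyK.
  move=> /(SN_mapP hT.2)[rho d psT]; split; first exact: hT.
  exists (realify rho); rewrite realifyK; split; last exact: psT.
  by exists rho.
move=> [_ [[rho d <-]]]; rewrite realifyK => psT; split; first exact: hT.
by apply/(SN_mapP hT.2); exists rho.
Qed.

End ClosednessCompactness.

(** * Lines in a space of maps *)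

Section Lines.
Variable R : realType.
Local Notation C := (R[i]).
Variables p q : nat.
Implicit Types (H A : set 'M[C]_(p, q)) (T S : 'M[C]_(p, q)).

Lemma line_unbounded A T S : S != 0 ->
  (forall e : R, A (T + e%:C *: S)) -> ~ cbounded A.
Proof.
move=> S0 AT [M [_ HM]].
have nS : 0 < `|realify S|.
  rewrite normr_gt0; apply: contra S0 => /eqP S0.
  by rewrite -[S]realifyK S0; apply/eqP/matrixP => i j; rewrite !mxE.
have M1 : M < M + 1 by rewrite ltrDl.
(* Gives e S the norm |M| + 2 + |T|, so that T + e S has norm at least |M| + 2, beyond the bound M +
   1. *)
pose e := (`|M| + 2 + `|realify T|) / `|realify S|.
have e0 : 0 <= e by rewrite divr_ge0 ?addr_ge0.
have := HM _ M1 (realify (T + e%:C *: S)) => /(_ (ex_intro2 _ _ _ (AT e) erefl)).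
rewrite realifyD realifyZ /= => le1.
have := ler_normB (realify T + e *: realify S) (realify T).
rewrite addrC addKr normrZ (ger0_norm e0) divfK ?gt_eqF //.
have := ler_norm M.
move: le1; set a := `|realify T + _|; set b := `|realify T|; clearbody a b.
by clear; lra.
Qed.

Lemma line_continuous T S :
  continuous (fun e : R => realify (T + e%:C *: S)).
Proof.
under eq_fun do rewrite realifyD realifyZ.
move=> e; apply: cvgD; first exact: cvg_cst.
by apply: cvgZr_tmp; exact: cvg_id.
Qed.

Lemma open_in_line H A T S : open_in H A -> A T ->
  (forall e : R, H (T + e%:C *: S)) -> exists2 e : R, 0 < e & A (T + e%:C *: S).
Proof.
move=> [_ [U [oU AU]]] AT HT.
have /nbhs_ballP[d /= d0 dU] :
    nbhs (0 : R) [set e : R | U (realify (T + e%:C *: S))].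
  apply: open_nbhs_nbhs; split.
    exact: open_preimage (@line_continuous T S) oU.
  by move: AT; rewrite AU /= scale0r addr0 => -[].
exists (d / 2); first by rewrite divr_gt0.
rewrite AU; split; first exact: HT.
apply: dU; rewrite /ball /= sub0r normrN.
by rewrite gtr0_norm ?divr_gt0 // gtr_pMr // invf_lt1 ?ltr1n.
Qed.

(** T is the limit of points of A as e tends to 0 from above. *)
Lemma closed_in_line H A T S : closed_in H A -> H T ->
  (forall e : R, 0 < e < 1 -> A (T + e%:C *: S)) -> A T.
Proof.
move=> [_ [U [cU AU]]] HT AT; rewrite AU; split=> //=.
have := closed_preimage (@line_continuous T S) cU.
rewrite closure_id /= => E.
suff : closure [set e : R | U (realify (T + e%:C *: S))] 0.
  by rewrite -E /= scale0r addr0.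
move=> B /nbhs_ballP[d /= d0 dB].
pose e := Num.min d 1 / 2.
have me : 0 < Num.min d 1 by rewrite lt_min d0 /=.
have e0 : 0 < e by rewrite divr_gt0.
have em : e < Num.min d 1 by rewrite gtr_pMr // invf_lt1 ?ltr1n.
have [ed e1] : e < d /\ e < 1 by move: em; rewrite lt_min => /andP.
exists e; split; last by apply: dB; rewrite /ball /= sub0r normrN gtr0_norm.
by have := AT e; rewrite e0 e1 AU => /(_ isT) [].
Qed.

End Lines.

(** * Star centers, unboundedness and counterexamples *)

Section StarCenters.
Variable R : realType.
Local Notation C := (R[i]).
Variables n m : nat.
Hypotheses (hn : (1 < n)%N) (hm : (1 < m)%N).

Let n0 : (0 < n)%N := ltnW hn.
Let m0 : (0 < m)%N := ltnW hm.

(** If c is not positive, [not_positive_escape] gives an endpoint in SP, hence in A, and a point of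
    the segment outside SN, hence outside A. One argument covers all three sets. *)
Lemma star_center_sub_P (A : set 'M[C]_(n * n, m * m)) :
  SPset R n m `<=` A -> A `<=` SNset R n m -> star_center A `<=` Pset R n m.
Proof.
move=> SPA ASN c [Ac star]; have [hc _] := ASN _ Ac.
split; first exact: hc.
apply: contrapT => npc.
have [x [SPx [l l01 nSN]]] := not_positive_escape n0 hm hc npc.
by apply/nSN/ASN/star => //; exact: SPA.
Qed.

(** A convex set is its own star center, so it would lie in the bounded set P. *)
Lemma not_convex_of_unbounded (A : set 'M[C]_(n * n, m * m)) :
  star_center A `<=` Pset R n m -> ~ cbounded A -> ~ cconvex A.
Proof.
move=> sA uA cA; apply: uA.
have [M [Mr HM]] := compact_bounded (@compact_P R n m).
exists M; split=> // x Mx _ [T AT <-]; apply: HM Mx _ _.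
by exists T => //; apply: sA; split=> // x' Ax'; exact: cA.
Qed.

(** The completely depolarizing channel, a point of all three star centers. *)
Definition depol : 'M[C]_(n * n, m * m) := trmap n ((m%:R^-1 : R)%:C *: 1%:M).

Lemma depol_HP : HPset R n m depol.
Proof.
have [[psD tD] _] := unit_density R m0.
exact: HPset_trmap (psd_herm psD) tD.
Qed.

Lemma trmap_positive (D : 'M[C]_m) : psdmx D -> positive_map (trmap n D).
Proof.
move=> psD X psX; rewrite app_trmap hermitian_trace_real ?(psd_herm psX) //.
apply: psdZ psD; rewrite /mxtrace Rec_sum.
by apply: sumr_ge0 => i _; exact: psd_diag_ge0.
Qed.

Lemma depol_P : Pset R n m depol.
Proof.
split; first exact: depol_HP.
by apply: trmap_positive; have [[]] := unit_density R m0.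
Qed.

Lemma depol_SP : SPset R n m depol.
Proof.
split; first exact: depol_HP.
apply/(SP_mapP depol_HP.2); have [d pd] := unit_density R n0.
exists ((n%:R^-1 : R)%:C *: 1%:M); split; [exact: d|exact: pd|].
by rewrite app_trmap d.2 scale1r; have [] := unit_density R m0.
Qed.

Lemma diff_delta_herm p (i j : 'I_p) :
  adjmx (delta_mx i i - delta_mx j j : 'M[C]_p) = delta_mx i i - delta_mx j j.
Proof. by rewrite adjmxD adjmxN !(psd_herm (delta_psd _ _)). Qed.

Lemma tr_diff_delta p (i j : 'I_p) :
  \tr (delta_mx i i - delta_mx j j : 'M[C]_p) = 0.
Proof. by rewrite linearB /= !tr_delta subrr. Qed.

Let i0 : 'I_n := Ordinal n0.
Let i1 : 'I_n := Ordinal hn.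
Let j0 : 'I_m := Ordinal m0.
Let j1 : 'I_m := Ordinal hm.

(** Along depol + e tr(G X) Z the maximally mixed state stays mapped to the maximally mixed state,
    because tr G = 0; tr Z = 0 keeps the line inside HP. *)
Lemma SP_unbounded : ~ cbounded (SPset R n m).
Proof.
pose G : 'M[C]_n := delta_mx i0 i0 - delta_mx i1 i1.
pose Z : 'M[C]_m := delta_mx j0 j0 - delta_mx j1 j1.
apply: (@line_unbounded R _ _ _ depol (rk1map G Z)).
  (* At the first diagonal unit the direction takes the value Z, which is nonzero. *)
  apply/eqP => S0; have := app_rk1map G Z (delta_mx i0 i0).
  rewrite S0 /app mulmx0 linear0 mulmxBl mul_delta_mx mul_delta_mx_0 //.
  rewrite subr0 tr_delta scale1r => /matrixP/(_ j0 j0)/eqP.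
  by rewrite !mxE eqxx /= subr0 eq_sym oner_eq0.
move=> e; have hT : HPset R n m (depol + e%:C *: rk1map G Z).
  apply: HPset_perturb depol_HP _ _.
    by apply: HermPres_rk1; exact: diff_delta_herm.
  by move=> X; rewrite app_rk1map linearZ /= tr_diff_delta mulr0.
split; first exact: hT.
apply/(SP_mapP hT.2); have [d pd] := unit_density R n0.
exists ((n%:R^-1 : R)%:C *: 1%:M); split; [exact: d|exact: pd|].
rewrite app_addl app_scalel app_rk1map -scalemxAr mulmx1 mxtraceZ.
rewrite tr_diff_delta mulr0 scale0r scaler0 addr0 app_trmap d.2 scale1r.
by have [] := unit_density R m0.
Qed.

(** tr(Y) E_0 is positive, hence SPR. Adding e tr(Y) (E_0 - E_1) with e > 0 gives the image of every
    density the diagonal entry - e at index 1, so the map is not even SN. *)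
Lemma SPR_not_open : ~ open_in (HPset R n m) (SPRset R n m).
Proof.
pose Z : 'M[C]_m := delta_mx j0 j0 - delta_mx j1 j1.
pose T := trmap n (delta_mx j0 j0 : 'M[C]_m).
have psD : psdmx (delta_mx j0 j0 : 'M[C]_m) := delta_psd R j0.
have hT : HPset R n m T := HPset_trmap n (psd_herm psD) (tr_delta R j0).
have hTe (e : R) : HPset R n m (T + e%:C *: trmap n Z).
  apply: HPset_perturb hT _ _.
    by apply: HermPres_rk1; [exact: adjmx1|exact: diff_delta_herm].
  by move=> X; rewrite app_trmap linearZ /= tr_diff_delta mulr0.
have PT : SPRset R n m T.
  by apply: P_SPR n0 _ _; split; [exact: hT|exact: trmap_positive psD].
move=> /open_in_line/(_ PT hTe)[e e0 /SPR_SN[_]].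
move=> /(SN_mapP (hTe e).2)[rho d /(psd_diag_ge0 j1)].
rewrite app_addl app_scalel !app_trmap d.2 !scale1r.
by rewrite !mxE /= sub0r add0r mulrN1 mul0r subr0 oppr_ge0 leNgt e0.
Qed.

(** At e = 0 the image of an invertible rho has the entry - rho_00 < 0 at (1, 1). For 0 < e < 1 some
    invertible rho has rho_00 < e, and its image is positive on the span of e_0 and e_1, where all
    images live. *)
Lemma SPR_not_closed : ~ closed_in (HPset R n m) (SPRset R n m).
Proof.
pose Z : 'M[C]_m := delta_mx j1 j1 - delta_mx j0 j0.
pose E0 : 'M[C]_m := delta_mx j0 j0.
pose E1 : 'M[C]_m := delta_mx j1 j1.
pose F : 'M[C]_n := delta_mx i0 i0.
have psE0 : psdmx E0 := delta_psd R j0.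
have psE1 : psdmx E1 := delta_psd R j1.
have hZ : adjmx Z = Z := diff_delta_herm j1 j0.
have hS : HermPres (trmap n Z) by apply: HermPres_rk1; [exact: adjmx1|exact: hZ].
have tS X : \tr (app (trmap n Z) X) = 0.
  by rewrite app_trmap linearZ /= tr_diff_delta mulr0.
pose T := trmap n E0 + (- 1)%:C *: rk1map F Z.
have hT : HPset R n m T.
  apply: HPset_perturb (HPset_trmap n (psd_herm psE0) (tr_delta R j0)) _ _.
    apply: HermPres_rk1; [exact: psd_herm (delta_psd R i0)|exact: hZ].
  by move=> X; rewrite app_rk1map linearZ /= tr_diff_delta mulr0.
have trF (X : 'M[C]_n) : \tr (F *m X) = X i0 i0.
  have -> : F = delta_mx i0 0 *m (delta_mx 0 i0 : 'rV[C]_n).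
    by rewrite mul_delta_mx.
  by rewrite -mulmxA mxtrace_mulC trace_mx11 -mulmxA -colE -rowE !mxE.
have hTe (e : R) : HPset R n m (T + e%:C *: trmap n Z).
  exact: HPset_perturb hT hS tS.
have TE (e : R) X : app (T + e%:C *: trmap n Z) X =
    \tr X *: E0 + (e%:C * \tr X - X i0 i0) *: Z.
  rewrite app_addl app_scalel app_trmap /T app_addl app_scalel.
  rewrite app_trmap app_rk1map trF.
  by rewrite rmorphN1 scaleN1r !scalerA -addrA scalerBl [X in _ + X]addrC.
have nT : ~ SPRset R n m T.
  move=> [_ /(SPR_mapP hT)[rho [d pd /(psd_diag_ge0 j1) + _]]].
  have := pd_diag_gt0 i0 pd; have := TE 0 rho.
  rewrite scale0r addr0 => ->; rewrite d.2 mul0r sub0r scale1r.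
  rewrite !mxE /= subr0 mulr1 add0r.
  by case: (rho i0 i0) => a b /=; rewrite oppr_ge0 leNgt => ->.
move=> cl; apply: nT; apply: (closed_in_line (S := trmap n Z) cl hT).
move=> e /andP[e0 e1]; split; first exact: hTe.
apply/(SPR_mapP (hTe e)).
have [du pdu] := unit_density R n0; set u := _ *: _ in du pdu.
(* Mixing E_1 with the maximally mixed state in proportion e/2 gives an invertible density with
   rho_00 = e/(2 n), below e. *)
pose rho : 'M[C]_n := (1 - e / 2)%:C *: delta_mx i1 i1 + (e / 2)%:C *: u.
have e20 : 0 < e / 2 by rewrite divr_gt0.
have e21 : 0 <= 1 - e / 2.
  by rewrite subr_ge0 ler_pdivrMr // mul1r ltW // (lt_trans e1) // ltr1n.
have pdr : pdmx rho.
  by apply: pdmxD; [exact: psdZ e21 (delta_psd R i1)|exact: pdmxZ].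
have dr : density rho.
  split; first exact: pdmx_psd.
  by rewrite mxtraceD 2!mxtraceZ du.2 tr_delta !mulr1 -rmorphD /= subrK.
(* The weight e - rho_00 of E_1 in the image of rho. *)
pose s := e - e / 2 * n%:R^-1.
have r00 : rho i0 i0 = (e / 2 * n%:R^-1)%:C.
  by rewrite !mxE /= mulr0 add0r mulr1 -rmorphM.
have n1 : n%:R^-1 < 1 :> R by rewrite invf_lt1 ?ltr1n ?ltr0n.
have ni : 0 < n%:R^-1 :> R by rewrite invr_gt0 ltr0n.
have s0 : 0 < s.
  rewrite subr_gt0 -mulrA gtr_pMr //.
  apply: mulr_ilt1 n1; [by rewrite invr_ge0|exact: ltW|].
  by rewrite invf_lt1 // ltr1n.
have s1 : 0 < 1 - s.
  by rewrite subr_gt0 (lt_trans _ e1) // gtrDl oppr_lt0 mulr_gt0.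
have Tr : app (T + e%:C *: trmap n Z) rho = (1 - s)%:C *: E0 + s%:C *: E1.
  rewrite TE dr.2 r00 mulr1 scale1r -rmorphB -/s /Z -/E0 -/E1.
  by rewrite (rmorphB (real_complex R) 1 s) scalerBr scalerBl scale1r addrAC addrA.
exists rho; rewrite Tr; split; [exact: dr|exact: pdr| |].
  by apply: psdD; [exact: psdZ (ltW s1) psE0|exact: psdZ (ltW s0) psE1].
move=> v /eqP; rewrite qformD !qformZ paddr_eq0; last 2 first.
- by rewrite mulr_ge0 ?(ltW s1) // psd_qform.
- by rewrite mulr_ge0 ?(ltW s0) // psd_qform.
rewrite !mulf_eq0 (gt_eqF s0) (gt_eqF s1) /= => /andP[/eqP q0 /eqP q1] a.
(* E_0 and E_1 both kill v, and every value of the map is a combination of them. *)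
have v0 := psd_qform_eq0 psE0 q0; have v1 := psd_qform_eq0 psE1 q1.
rewrite TE mulmxDl -!scalemxAl v0 scaler0 add0r /Z mulmxBl -/E0 -/E1 v0 v1.
by rewrite subrr scaler0.
Qed.

End StarCenters.

(** * Assembly of the five claims *)

Theorem theorem3 (R : realType) (n m : nat) (hn : (1 < n)%N) (hm : (1 < m)%N) :
  let HP := HPset R n m in
  let SP := SPset R n m in
  let SN := SNset R n m in
  let SPR := SPRset R n m in
  let P := Pset R n m in
  let CP := CPset R n m in
  [/\ [/\ open_in HP SP, ~ cbounded SP, ~ cconvex SP, star_shaped SP
        & star_center SP = SP `&` P],
      [/\ closed_in HP SN, ~ cbounded SN, ~ cconvex SN, star_shaped SN
        & star_center SN = P],
      [/\ ~ cbounded SPR, ~ open_in HP SPR /\ ~ closed_in HP SPR, ~ cconvex SPR,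
          star_shaped SPR & star_center SPR = P],
      ccompact P /\ cconvex P
    & ccompact CP /\ cconvex CP].
Proof.
move=> HP SP SN SPR P CP.
have n0 : (0 < n)%N := ltnW hn.
have SPSPR : SP `<=` SPR := @SP_SPR R n m.
have SPRSN : SPR `<=` SN := @SPR_SN R n m.
have unbd (A : set _) : SP `<=` A -> ~ cbounded A.
  move=> SPA [M [Mr HM]]; have := @SP_unbounded R n m hn hm; apply.
  exists M; split=> // x Mx _ [T SPT <-]; apply: HM Mx _ _.
  by exists T => //; exact: SPA.
have subP (A : set _) : SP `<=` A -> A `<=` SN -> star_center A `<=` P.
  exact: star_center_sub_P.
have nconv (A : set _) : SP `<=` A -> A `<=` SN -> ~ cconvex A.
  move=> SPA ASN; apply: (not_convex_of_unbounded (n := n) (m := m)).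
    exact: subP.
  exact: unbd.
have cSP : star_center SP = SP `&` P.
  apply/seteqP; split=> c.
    by move=> sc; split; [case: sc|apply: (subP SP) sc => // T /SPSPR/SPRSN].
  by move=> Pc; split; [case: Pc|exact: SP_star].
have cSN : star_center SN = P.
  apply/seteqP; split=> c.
    by apply: subP => // T /SPSPR/SPRSN.
  by move=> Pc; split; [exact/SPRSN/P_SPR|exact: SN_star].
have cSPR : star_center SPR = P.
  apply/seteqP; split=> c; first exact: subP.
  by move=> Pc; split; [exact: P_SPR|exact: SPR_star].
have SPSN : SP `<=` SN by move=> T /SPSPR/SPRSN.
split.
- split; [exact: open_SP|exact: unbd|exact: nconv| |exact: cSP].
  by exists (depol R n m); rewrite cSP; split; [exact: depol_SP|exact: depol_P].
- split; [exact: closed_SN|exact: unbd|exact: nconv| |exact: cSN].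
  by exists (depol R n m); rewrite cSN; exact: depol_P.
- split; [exact: unbd| |exact: nconv| |exact: cSPR].
    by split; [exact: SPR_not_open|exact: SPR_not_closed].
  by exists (depol R n m); rewrite cSPR; exact: depol_P.
- by split; [exact: compact_P|exact: convex_P].
- by split; [exact: compact_CP|exact: convex_CP].
Qed.
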